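(* Let $\Gamma$ be the multi-linear operator of the context with spectral function $\mu(p)$, and assume $p_0>1$. Let $R$ be the probability measure on $[0,\infty)$ defined in the context, and let $$m_s=\int_0^\infty d\tau\,R(\tau)\tau^s,\qquad s>0.$$ Then: [i] If the equation $\mu(s)=\mu(1)$ has the only solution $s=1$, then $m_s<\infty$ for any $s>0$. [ii] If this equation has two solutions $s=1$ and $s=s_*>1$, then $m_s<\infty$ for $s<s_*$ and $m_s=\infty$ for $s>s_*$. [iii] (In the case of [ii]) $m_{s_*}<\infty$ only if $I_n(s_* )=0$ for all $n=2,\dots,N$, where $$I_n(s)=\int_{\mathbb{R}_+^n}da_1\cdots da_n\,A_n(a_1,\dots,a_n)\int_{\mathbb{R}_+^n}d\tau_1\cdots d\tau_n\,g_n^{(s)}(a_1\tau_1,\dots,a_n\tau_n)\prod_{j=1}^nR(\tau_j),$$ $$g_n^{(s)}(y_1,\dots,y_n)=\Big(\sum_{k=1}^ny_k\Big)^s-\sum_{k=1}^ny_k^s.$$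
   Context: $\mathbb{R}_+=[0,\infty)$. Let $N\ge2$, $\alpha_n\ge0$, $\sum_{n=1}^N\alpha_n=1$, $\alpha_N>0$. For each $n$, $A_n(a_1,\dots,a_n)\ge0$ is a generalized density of a probability measure on $\mathbb{R}_+^n$ with compact support, symmetric under permutations of its arguments. For bounded continuous $u$ on $\mathbb{R}_+$ define $$\Gamma(u)(x)=\sum_{n=1}^N\alpha_n\int_0^\infty da_1\cdots\int_0^\infty da_n\,A_n(a_1,\dots,a_n)\prod_{k=1}^nu(a_kx),$$ $$K(a)=\sum_{n=1}^Nn\alpha_n\int_0^\infty da_2\cdots\int_0^\infty da_n\,A_n(a,a_2,\dots,a_n),\qquad\lambda(p)=\int_0^\infty da\,K(a)a^p,\qquad\mu(p)=\frac{\lambda(p)-1}{p}\quad(p>0).$$ $p_0\in(0,\infty]$ denotes the unique point at which $\mu$ attains its minimum on $(0,\infty)$, with $p_0=\infty$ if $\mu$ is decreasing on all of $(0,\infty)$. For $\mu\in\mathbb{R}$, $\Gamma_\mu(u)(x)=\int_0^1d\tau\,\Gamma(u)(x\tau^\mu)$. When $p_0>1$, the iterates $w_{n+1}=\Gamma_{\mu(1)}(w_n)$, $w_0=e^{-x}$, converge pointwise to a function $w$ which is the Laplace transform of a probability measure $R(\tau)d\tau$ on $[0,\infty)$ ($R$ being a generalized non-negative function): $$w(x)=\int_0^\infty d\tau\,R(\tau)e^{-\tau x},\qquad \int_0^\infty d\tau\,R(\tau)=\int_0^\infty d\tau\,R(\tau)\,\tau=1.$$ *)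

(* Defs.v *)
From HB Require Import structures.
From mathcomp Require Import all_boot all_order all_algebra all_fingroup.
From mathcomp Require Import all_classical all_reals all_analysis.

Set Implicit Arguments.
Unset Strict Implicit.
Unset Printing Implicit Defensive.

Import Order.TTheory GRing.Theory Num.Theory.
Import numFieldNormedType.Exports.

Local Open Scope classical_set_scope.
Local Open Scope ring_scope.

(* R^n is represented by n.-tuple R, which carries the product (Borel)
   sigma-algebra. *)
Definition orthant (R : realType) (n : nat) : set (n.-tuple R) :=
  [set a | forall i, 0 <= tnth a i].
Arguments orthant : clear implicits.

(* Tuples have no topology in the library, so compactness is expressed
   through the corresponding row vectors. *)
Definition compactly_supported (R : realType) (n : nat)
    (m : probability (n.-tuple R) R) : Prop :=
  exists C : set 'rV[R]_n,
    compact C /\ m [set a | ~ C (\row_i tnth a i)] = 0%E.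

Definition permutation_symmetric (R : realType) (n : nat)
    (m : probability (n.-tuple R) R) : Prop :=
  forall (s : 'S_n) (B : set (n.-tuple R)), measurable B ->
    m [set a | B [tuple tnth a (s i) | i < n]] = m B.

(* A "generalized density" A_n is the probability measure it stands for.
   [alpha] and [A] are indexed by all of nat, but only 1 <= n <= N is used. *)
Section Model.
Variables (R : realType) (N : nat) (alpha : nat -> R).
Variable A : forall n : nat, probability (n.-tuple R) R.

Definition Gamma (u : R -> R) (x : R) : R :=
  \sum_(1 <= n < N.+1) alpha n *
    \int[A n]_(a in orthant R n) \prod_(k < n) u (tnth a k * x).

(* The measure K(a)da: the weighted sum of the laws of the first coordinate
   [nth 0 a 0] of a under A_n. *)
Definition K (B : set R) : \bar R :=
  (\sum_(1 <= n < N.+1) (n%:R * alpha n)%:E *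
     pushforward (A n) (fun a : n.-tuple R => nth 0%R a 0) B)%E.

Definition lambda (p : R) : R :=
  fine (\int[K]_(a in `[0%R, +oo[) (a `^ p)%:E)%E.

Definition mu (p : R) : R := (lambda p - 1) / p.

Definition Gamma_ (m : R) (u : R -> R) (x : R) : R :=
  \int[@lebesgue_measure R]_(tau in `[0, 1]) Gamma u (x * tau `^ m).

Definition w_ (n : nat) : R -> R :=
  iter n (Gamma_ (mu 1)) (fun x => expR (- x)).

End Model.

(* [is_p0 f p] : p in (0, +oo] is the unique minimum point of f on ]0, +oo[,
   with p = +oo when f is decreasing there. *)
Definition is_p0 (R : realType) (f : R -> R) (p : \bar R) : Prop :=
  match p with
  | EFin p0 => 0 < p0 /\ forall q, 0 < q -> q != p0 -> f p0 < f q
  | EPInf => forall q r, 0 < q -> q < r -> f r < f q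
  | ENInf => False
  end.

Section Moments.
Variables (R : realType) (P : probability R R).

Definition moment (s : R) : \bar R :=
  (\int[P]_(tau in `[0%R, +oo[) (tau `^ s)%:E)%E.

(* \int P(dtau_1) ... \int P(dtau_n) f(tau_1, ..., tau_n) over R_+^n *)
Fixpoint iterated_integral (n : nat) : (n.-tuple R -> \bar R) -> \bar R :=
  match n with
  | 0 => fun f => f [tuple]
  | n'.+1 => fun f =>
      (\int[P]_(tau in `[0%R, +oo[)
         iterated_integral (fun t : n'.-tuple R => f [tuple of tau :: t]))%E
  end.

Definition g (n : nat) (s : R) (y : n.-tuple R) : R :=
  (\sum_(k < n) tnth y k) `^ s - \sum_(k < n) tnth y k `^ s.

Definition I_ (n : nat) (m : probability (n.-tuple R) R) (s : R) : \bar R :=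
  (\int[m]_(a in orthant R n)
     iterated_integral (fun tau : n.-tuple R =>
       (g s [tuple (tnth a j * tnth tau j)%R | j < n])%:E))%E.

End Moments.

(* Main.v *)
(* The operator Gamma acts on Laplace transforms of laws on R_+: if X_1, X_2, ...
   are independent with law L, (a_1, ..., a_n) has law A_n with probability
   alpha_n and U is uniform on [0, 1], then Gamma_mu maps the transform of L to
   that of the law [step L] of U^mu (a_1 X_1 + ... + a_n X_n). Hence the w_n are
   the transforms of the iterates of [step] from the Dirac mass at 1, and P and
   [step P] have the same transform.

   Since E U^(mu s) = 1 / (1 + mu s), the bound
   (sum y)^s <= sum y^s + C sum_(j != k) y_j^(s-1) y_k shows that [step]
   multiplies the s-th moment by at most lambda(s) / (1 + mu(1) s), up to a
   constant controlled by the moment of order s - 1. That ratio is < 1 exactly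
   when mu(s) < mu(1), and the moments of the iterates are then bounded.

   Moments pass to the limit because
   C m_s = int_0^oo x^(-s-1) E (1 - e^(-x X))^k dx for k >= s + 1, where the
   expectation is a k-th difference of the Laplace transform. The same formula
   gives m_s(step P) <= m_s(P) from the equality of transforms. If m_s were
   finite at s_star, where lambda(s) = 1 + mu(1) s, there would be equality in
   sum y^s <= (sum y)^s almost surely, so almost surely at most one a_j would be
   nonzero; Young's inequality a <= a^q / q + (1 - 1/q) then gives
   mu(1) <= mu(q) for all q > 1, against p_0 > 1. So m_s is infinite at s_star,
   which makes [iii] vacuous. *)
Require Import Defs.
From HB Require Import structures.
From mathcomp Require Import all_boot all_order all_algebra all_fingroup.
From mathcomp Require Import all_classical all_reals all_analysis.
From mathcomp Require Import measurable_realfun ring lra.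

Set Implicit Arguments.
Unset Strict Implicit.
Unset Printing Implicit Defensive.

Import Order.TTheory GRing.Theory Num.Theory.
Import numFieldNormedType.Exports.

Local Open Scope classical_set_scope.
Local Open Scope ring_scope.

(** * Image laws, mixtures and powers of probability measures *)

Section pushforward_probability.
Context d d' (T : measurableType d) (T' : measurableType d') (R : realType).
Variables (P : probability T R) (f : T -> T') (mf : measurable_fun setT f).

Let f_mixin := isMeasurableFun.Build _ _ _ _ f mf.
Let f_mfun : {mfun T >-> T'} := HB.pack f f_mixin.

Definition image_law : probability T' R := distribution P f_mfun.

Lemma integral_image_law (h : T' -> \bar R) :
  measurable_fun setT h -> (forall x, 0 <= h x)%E ->
  (\int[image_law]_x h x = \int[P]_x h (f x))%E.
Proof. by move=> mh h0; rewrite ge0_integral_pushforward. Qed.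

End pushforward_probability.

Section mixture.
Context d (T : measurableType d) (R : realType) (n : nat) (c : nat -> R).
Hypothesis c_ge0 : forall i, 0 <= c i.
Hypothesis c_sum : \sum_(i < n) c i = 1.
Variable p : nat -> probability T R.

(** [msum] takes a sequence of measures indexed by all of nat, hence a sign condition on every [c i]
    and not only on those below [n]. *)
Definition mixture_set : set T -> \bar R :=
  msum (fun i => mscale (NngNum (c_ge0 i)) (p i)) n.

HB.instance Definition _ := Measure.on mixture_set.

Let mixture_setT : mixture_set setT = 1%E.
Proof.
rewrite /mixture_set /msum (eq_bigr (fun i : 'I_n => (c i)%:E)).
  by rewrite sumEFin c_sum.
by move=> i _; rewrite /= /mscale/= probability_setT mule1.
Qed.

HB.instance Definition _ :=
  Measure_isProbability.Build _ _ _ mixture_set mixture_setT.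

Definition mixture : probability T R := mixture_set.

Lemma integral_mixture (h : T -> \bar R) :
  measurable_fun setT h -> (forall x, 0 <= h x)%E ->
  (\int[mixture]_x h x = \sum_(i < n) (c i)%:E * \int[p i]_x h x)%E.
Proof.
move=> mh h0; rewrite ge0_integral_measure_sum//.
by apply: eq_bigr => i _; rewrite ge0_integral_mscale.
Qed.

End mixture.

Section power.
Context d (T : measurableType d) (R : realType) (L : probability T R).

(** The law of [n] independent copies. Recursion through cons lets Tonelli peel off one coordinate
    at a time. *)
Fixpoint power (n : nat) : probability (n.-tuple T) R :=
  match n with
  | 0 => dirac [tuple]
  | n'.+1 => image_law (L \x power n')%E
      (measurable_cons (measurable_fst : measurable_fun setT
         (@fst T (n'.-tuple T))) measurable_snd)
  end.

Lemma integral_power0 (f : 0.-tuple T -> \bar R) :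
  measurable_fun setT f ->
  (\int[power 0]_v f v = f [tuple])%E.
Proof. by move=> mf; rewrite integral_dirac//= diracT mul1e. Qed.

Lemma integral_powerS n (f : n.+1.-tuple T -> \bar R) :
  measurable_fun setT f -> (forall v, 0 <= f v)%E ->
  (\int[power n.+1]_v f v =
   \int[L]_t \int[power n]_v f [the n.+1.-tuple T of t :: v])%E.
Proof.
move=> mf f0; rewrite integral_image_law// fubini_tonelli1//.
apply: measurableT_comp => //.
exact: (measurable_cons (measurable_fst) measurable_snd).
Qed.

(** Independence, by induction on [n]: after Tonelli the factor of the head is a constant for the
    integral over the tail. *)
Lemma integral_power_prod n (h : 'I_n -> T -> R) :
  (forall i, measurable_fun setT (h i)) -> (forall i x, 0 <= h i x) ->
  (\int[power n]_v (\prod_(i < n) h i (tnth v i))%:E =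
   \prod_(i < n) \int[L]_x (h i x)%:E)%E.
Proof.
have mprod k (g : 'I_k -> T -> R) : (forall i, measurable_fun setT (g i)) ->
    measurable_fun setT (fun v : k.-tuple T => (\prod_(i < k) g i (tnth v i))%:E).
  move=> mg; apply/measurable_EFinP; apply: measurable_prod => i _.
  by apply: measurableT_comp => //; exact: measurable_tnth.
elim: n h => [|n IH] h mh h0.
  rewrite integral_power0; last exact: mprod.
  by rewrite !big_ord0.
rewrite integral_powerS; first last.
- by move=> v; rewrite lee_fin; apply: prodr_ge0.
- exact: mprod.
transitivity (\int[L]_t ((h ord0 t)%:E *
   \prod_(i < n) \int[L]_x (h (lift ord0 i) x)%:E))%E.
  apply: eq_integral => t _.
  rewrite -IH//.
  rewrite -ge0_integralZl//; first last.
  - by rewrite lee_fin.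
  - by move=> v _; rewrite lee_fin; apply: prodr_ge0.
  - exact: (mprod n (fun i => h (lift ord0 i))).
  apply: eq_integral => v _.
  rewrite big_ord_recl/= -EFinM; congr (_ * _)%:E.
  by apply: eq_bigr => i _; rewrite tnthS.
rewrite big_ord_recl ge0_integralZr//.
- exact/measurable_EFinP.
- by move=> x _; rewrite lee_fin.
by apply: prode_ge0 => i _; apply: integral_ge0 => x _; rewrite lee_fin.
Qed.

End power.

(** * Laplace transforms and the operator on laws *)

Lemma prob_integral_cst d (T : measurableType d) (R : realType)
  (P : probability T R) (r : R) : (\int[P]_x r%:E = r%:E)%E.
Proof. by rewrite integral_cst//= probability_setT mule1. Qed.

Lemma ge0_le_integralE d (T : measurableType d) (R : realType)
    (P : {measure set T -> \bar R}) (f g : T -> R) :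
  measurable_fun setT f -> measurable_fun setT g ->
  (forall x, 0 <= f x) -> (forall x, f x <= g x) ->
  (\int[P]_x (f x)%:E <= \int[P]_x (g x)%:E)%E.
Proof.
move=> mf mg f0 fg; apply: ge0_le_integral => //.
- by move=> x _; rewrite lee_fin.
- exact/measurable_EFinP.
- exact/measurable_EFinP.
- by move=> x _; rewrite lee_fin.
Qed.

(* For a nonnegative integrand of mass at most 1 the real-valued integral is
   not the junk value [fine +oo = 0]. *)
Lemma EFin_Rintegral_le1 d (T : measurableType d) (R : realType)
    (P : probability T R) (f : T -> R) :
  measurable_fun setT f -> (forall x, 0 <= f x <= 1) ->
  ((\int[P]_x f x)%R%:E = \int[P]_x (f x)%:E)%E.
Proof.
move=> mf f01; rewrite /Rintegral fineK// ge0_fin_numE; last first.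
  by apply: integral_ge0 => x _; rewrite lee_fin; case/andP: (f01 x).
apply: (@le_lt_trans _ _ (\int[P]_x 1%:E)%E); last first.
  by rewrite prob_integral_cst ltry.
by apply: ge0_le_integralE => // x; case/andP: (f01 x).
Qed.

Section transforms.
Context (R : realType).
Implicit Types (L : probability R R).

Definition lap L (x : R) : R := \int[L]_t expR (- (x * `|t|)).

Definition mom (s : R) L : \bar R := (\int[L]_t (`|t| `^ s)%:E)%E.

Lemma measurable_powRn (s : R) : measurable_fun setT (fun t : R => `|t| `^ s).
Proof.
by apply: (measurableT_comp (measurable_powR s)); exact: normr_measurable.
Qed.

Lemma measurable_lap_kernel :
  measurable_fun setT (fun z : R * R => expR (- (z.1 * `|z.2|))).
Proof.
apply: measurableT_comp => //; apply: measurableT_comp => //.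
by apply: measurable_funM => //; exact: measurableT_comp.
Qed.

Lemma measurable_lap_kernel2 x :
  measurable_fun setT (fun t : R => expR (- (x * `|t|))).
Proof.
apply: measurableT_comp => //; apply: measurableT_comp => //.
by apply: measurable_funM => //; exact: measurableT_comp.
Qed.

Lemma expRN_le1 (x t : R) : 0 <= x -> expR (- (x * `|t|)) <= 1.
Proof. by move=> x0; rewrite expR_le1 oppr_le0 mulr_ge0. Qed.

Lemma lapE L x : 0 <= x ->
  (lap L x)%:E = (\int[L]_t (expR (- (x * `|t|)))%:E)%E.
Proof.
move=> x0; apply: EFin_Rintegral_le1; first exact: measurable_lap_kernel2.
by move=> t; rewrite expR_ge0 expRN_le1.
Qed.

Lemma lap_ge0 L x : 0 <= lap L x.
Proof.
by apply: fine_ge0; apply: integral_ge0 => t _; rewrite lee_fin expR_ge0.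
Qed.

Lemma lap_le1 L x : 0 <= x -> lap L x <= 1.
Proof.
move=> x0; rewrite -lee_fin lapE// -(prob_integral_cst L 1).
apply: ge0_le_integralE => //; first exact: measurable_lap_kernel2.
by move=> t; rewrite expRN_le1.
Qed.

(** Tonelli gives measurability of partial integrals of any nonnegative kernel, so negative [x],
    where the integral may be infinite, are covered too. *)
Lemma measurable_lap L : measurable_fun setT (lap L).
Proof.
apply: (measurableT_comp (f := fine)); first exact: fine_measurable.
apply: (@measurable_fun_fubini_tonelli_F _ _ R R R L
  (fun z : R * R => (expR (- (z.1 * `|z.2|)))%:E)).
  by apply/measurable_EFinP; exact: measurable_lap_kernel.
by move=> z; rewrite lee_fin expR_ge0.
Qed.

End transforms.

(** Bridge between the integrals over the half-line or the orthant in the model and the integrals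
    over the whole space used below. *)
Lemma integral_full d (T : measurableType d) (R : realType)
    (P : probability T R) (D : set T) (f : T -> \bar R) :
  measurable D -> P D = 1%E -> measurable_fun setT f ->
  (forall x, 0 <= f x)%E ->
  (\int[P]_(x in D) f x = \int[P]_x f x)%E.
Proof.
move=> mD PD mf f0.
have PDC : P (~` D) = 0%E by rewrite probability_setC// PD subee.
rewrite [RHS](@ge0_negligible_integral _ _ _ P setT (~` D))//.
- by rewrite setTD setCK.
- exact: measurableC.
Qed.

(** Dominated convergence with the constant 1, integrable for a probability. The limit inherits the
    bounds, so that its real integral is not a default value. *)
Lemma bounded_cvg d (T : measurableType d) (R : realType)
    (P : probability T R) (f_ : nat -> T -> R) (f : T -> R) :
  (forall k, measurable_fun setT (f_ k)) -> measurable_fun setT f ->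
  (forall k x, 0 <= f_ k x <= 1) ->
  (forall x, f_ ^~ x @ \oo --> f x) ->
  ((fun k => \int[P]_x f_ k x) @ \oo --> \int[P]_x f x).
Proof.
move=> mf_ mf f01 f_f.
have mE (g : T -> R) : measurable_fun setT g ->
  measurable_fun setT (EFin \o g) by move=> ?; exact/measurable_EFinP.
have f01' x : 0 <= f x <= 1.
  have f0 := f_f x; rewrite -(cvg_lim _ f0)//; apply/andP; split.
    apply: limr_ge; first by apply: cvgP f0.
    by apply: nearW => k; case/andP: (f01 k x).
  apply: limr_le; first by apply: cvgP f0.
  by apply: nearW => k; case/andP: (f01 k x).
have [_ _ cvgf] : [/\ P.-integrable setT (EFin \o f),
    (fun k => \int[P]_x `|(f_ k x)%:E - (f x)%:E|)%E @ \oo --> (0 : \bar R) &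
    (fun k => \int[P]_x (f_ k x)%:E)%E @ \oo --> (\int[P]_x (f x)%:E)%E].
  apply: (@dominated_convergence _ _ _ P setT measurableT
    (fun k x => (f_ k x)%:E) (EFin \o f) (cst 1%E)).
  - by move=> k; exact: mE.
  - exact: mE.
  - by apply: aeW => x _; apply/fine_cvgP; split; [exact: nearW|exact: f_f].
  - exact: finite_measure_integrable_cst.
  - apply: aeW => x k _ /=; have /andP[f0 f1] := f01 k x.
    by rewrite lee_fin ger0_norm.
rewrite -EFin_Rintegral_le1// in cvgf.
by have /fine_cvgP[_] := cvgf.
Qed.

(** * Action of the operator on laws and on their transforms *)

Section operator.
Context (R : realType) (N : nat) (c : nat -> R).
Hypothesis c_ge0 : forall i, 0 <= c i.
Hypothesis c_sum : \sum_(i < N) c i = 1.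
Variable A : forall n : nat, probability (n.-tuple R) R.
Variable m : R.

Definition unif : probability (measurableTypeR R) R := uniform_prob (@ltr01 R).

(* Absolute values spare every support condition: they only change what happens
   off the orthant, which is null for the laws of the model. *)
Definition wsum n (z : n.-tuple R * n.-tuple R) : R :=
  \sum_(j < n) `|tnth z.1 j| * `|tnth z.2 j|.

Lemma wsum_ge0 n z : 0 <= @wsum n z.
Proof. by apply: sumr_ge0 => j _; rewrite mulr_ge0. Qed.

Lemma measurable_wsum n : measurable_fun setT (@wsum n).
Proof.
apply: measurable_sum => j; apply: measurable_funM;
  apply: measurableT_comp => //.
- by apply: (measurableT_comp (measurable_tnth j)); exact: measurable_fst.
- by apply: (measurableT_comp (measurable_tnth j)); exact: measurable_snd.
Qed.

(** The variable [U^m (a_1 X_1 + ... + a_n X_n)], up to absolute values, as a function of [U], [a]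
    and [X]. *)
Definition combine n (z : measurableTypeR R * (n.-tuple R * n.-tuple R)) : R :=
  z.1 `^ m * wsum z.2.

Lemma measurable_combine n : measurable_fun setT (@combine n).
Proof.
apply: measurable_funM.
  by apply: (measurableT_comp (measurable_powR m)); exact: measurable_fst.
by apply: (measurableT_comp (@measurable_wsum n)); exact: measurable_snd.
Qed.

Definition smear L n : probability R R :=
  image_law (unif \x (A n \x power L n))%E (@measurable_combine n).

Lemma integral_smear L n (h : R -> \bar R) :
  measurable_fun setT h -> (forall x, 0 <= h x)%E ->
  (\int[smear L n]_x h x =
   \int[unif]_tau \int[A n]_a \int[power L n]_v h (tau `^ m * wsum (a, v))%R)%E.
Proof.
move=> mh h0.
have mhc : measurable_fun setT (h \o @combine n).
  by apply: measurableT_comp => //; exact: measurable_combine.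
rewrite integral_image_law// fubini_tonelli1//.
apply: eq_integral => tau _; rewrite /fubini_F fubini_tonelli1//.
exact: (measurableT_comp mhc (measurable_pair1 tau)).
Qed.

(** The exponential of the weighted sum is a product over the coordinates, and independence makes
    its expectation a product of transforms. *)
Lemma lap_smear L n x : 0 <= x ->
  ((lap (smear L n) x)%:E =
   \int[unif]_tau \int[A n]_a
     (\prod_(j < n) lap L (x * tau `^ m * `|tnth a j|))%R%:E)%E.
Proof.
move=> x0; rewrite lapE// integral_smear; first last.
- by move=> t; rewrite lee_fin expR_ge0.
- by apply/measurable_EFinP; exact: measurable_lap_kernel2.
apply: eq_integral => tau _; apply: eq_integral => a _.
transitivity (\int[power L n]_v (\prod_(j < n)
    expR (- (x * tau `^ m * `|tnth a j| * `|tnth v j|)))%R%:E)%E.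
  apply: eq_integral => v _; rewrite -expR_sum; congr (expR _)%:E.
  rewrite ger0_norm ?mulr_ge0 ?powR_ge0 ?wsum_ge0//.
  by rewrite sumrN mulrA /wsum mulr_sumr; congr (- _); apply: eq_bigr => j _;
     rewrite mulrA.
rewrite (integral_power_prod L (h := fun j t =>
  expR (- (x * tau `^ m * `|tnth a j| * `|t|)))); first last.
- by move=> j t; exact: expR_ge0.
- by move=> j; exact: measurable_lap_kernel2.
rewrite -prodEFin; apply: eq_bigr => j _.
by rewrite lapE// !mulr_ge0// powR_ge0.
Qed.

Lemma mom_smear s L n :
  (mom s (smear L n) = (\int[unif]_tau (tau `^ (m * s))%R%:E) *
   \int[A n]_a \int[power L n]_v (wsum (a, v) `^ s)%R%:E)%E.
Proof.
have mw : measurable_fun setT (fun z => (@wsum n z `^ s)%R%:E).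
  apply/measurable_EFinP.
  apply: (measurableT_comp (measurable_powR s)); exact: measurable_wsum.
rewrite /mom integral_smear; first last.
- by move=> t; rewrite lee_fin powR_ge0.
- by apply/measurable_EFinP; exact: measurable_powRn.
rewrite -ge0_integralZr//; first last.
- apply: integral_ge0 => a _; apply: integral_ge0 => v _.
  by rewrite lee_fin powR_ge0.
- by move=> t _; rewrite lee_fin powR_ge0.
- by apply/measurable_EFinP; exact: measurable_powR.
apply: eq_integral => tau _.
rewrite -ge0_integralZl//; first last.
- by rewrite lee_fin powR_ge0.
- by move=> a _; apply: integral_ge0 => v _; rewrite lee_fin powR_ge0.
- apply: (measurable_fun_fubini_tonelli_F (fun z => (@wsum n z `^ s)%R%:E)) => //.
  by move=> z; rewrite lee_fin powR_ge0.
apply: eq_integral => a _.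
rewrite -ge0_integralZl//; first last.
- by rewrite lee_fin powR_ge0.
- by move=> v _; rewrite lee_fin powR_ge0.
- by exact: (measurableT_comp mw (measurable_pair1 a)).
apply: eq_integral => v _; rewrite -EFinM; congr (_%:E).
rewrite ger0_norm ?mulr_ge0 ?powR_ge0 ?wsum_ge0//.
by rewrite powRM ?powR_ge0 ?wsum_ge0// -powRrM.
Qed.

(** Index [i] stands for [n = i + 1], as the sums of the model start at 1. *)
Definition step L : probability R R :=
  mixture c_ge0 c_sum (fun i => smear L i.+1).

Lemma mom_step s L :
  (mom s (step L) = (\int[unif]_tau (tau `^ (m * s))%R%:E) *
   \sum_(i < N) (c i)%:E *
    \int[A i.+1]_a \int[power L i.+1]_v (wsum (a, v) `^ s)%R%:E)%E.
Proof.
rewrite /mom integral_mixture; first last.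
- by move=> t; rewrite lee_fin powR_ge0.
- by apply/measurable_EFinP; exact: measurable_powRn.
rewrite ge0_sume_distrr; last first.
  move=> i _; rewrite mule_ge0 ?lee_fin//.
  by apply: integral_ge0 => a _; apply: integral_ge0 => v _;
    rewrite lee_fin powR_ge0.
by apply: eq_bigr => i _; rewrite -/(mom _ _) mom_smear muleCA.
Qed.

Definition lap_prod L n (z : R * n.-tuple R) : R :=
  \prod_(j < n) lap L (z.1 * `|tnth z.2 j|).

Lemma lap_prod_ge0 L n z : 0 <= @lap_prod L n z.
Proof. by apply: prodr_ge0 => j _; exact: lap_ge0. Qed.

Lemma lap_prod_le1 L n z : 0 <= z.1 -> @lap_prod L n z <= 1.
Proof.
move=> z0; apply: prodr_ile1 => j _.
by rewrite lap_ge0 lap_le1// mulr_ge0.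
Qed.

Lemma measurable_lap_prod L n : measurable_fun setT (@lap_prod L n).
Proof.
apply: measurable_prod => j _.
apply: (measurableT_comp (measurable_lap L)).
apply: measurable_funM; first exact: measurable_fst.
apply: measurableT_comp => //.
by apply: (measurableT_comp (measurable_tnth j)); exact: measurable_snd.
Qed.

Lemma measurable_lap_prod2 L n y :
  measurable_fun setT (fun a => @lap_prod L n (y, a)).
Proof. exact: measurableT_comp (@measurable_lap_prod L n) (measurable_pair1 y). Qed.

(** The operator [Gamma] applied to [lap L], before the averaging over [tau]; [Gamma_gain] makes the
    link. *)
Definition gain L (y : R) : R :=
  \sum_(i < N) c i * \int[A i.+1]_a lap_prod L (y, a).

Lemma gainE L y : 0 <= y ->
  ((gain L y)%:E =
   \sum_(i < N) (c i)%:E * \int[A i.+1]_a (lap_prod L (y, a))%:E)%E.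
Proof.
move=> y0; rewrite /gain -sumEFin; apply: eq_bigr => i _.
rewrite EFinM EFin_Rintegral_le1//; first exact: measurable_lap_prod2.
by move=> a; rewrite lap_prod_ge0 lap_prod_le1.
Qed.

Lemma gain_ge0 L y : 0 <= gain L y.
Proof.
apply: sumr_ge0 => i _; rewrite mulr_ge0//; apply: Rintegral_ge0 => a _.
exact: lap_prod_ge0.
Qed.

Lemma gain_le1 L y : 0 <= y -> gain L y <= 1.
Proof.
move=> y0; rewrite -c_sum; apply: ler_sum => i _.
rewrite ler_piMr// -lee_fin EFin_Rintegral_le1//; first last.
- by move=> a; rewrite lap_prod_ge0 lap_prod_le1.
- exact: measurable_lap_prod2.
rewrite -(prob_integral_cst (A i.+1) 1); apply: ge0_le_integralE => //.
- exact: measurable_lap_prod2.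
- by move=> a; exact: lap_prod_ge0.
- by move=> a; exact: lap_prod_le1.
Qed.

Lemma measurable_gain L : measurable_fun setT (gain L).
Proof.
apply: measurable_sum => i; apply: measurable_funM => //.
apply: (measurableT_comp (f := fine)); first exact: fine_measurable.
apply: (@measurable_fun_fubini_tonelli_F _ _ R _ R (A i.+1)
  (fun z => (@lap_prod L i.+1 z)%:E)).
  by apply/measurable_EFinP; exact: measurable_lap_prod.
by move=> z; rewrite lee_fin lap_prod_ge0.
Qed.

Lemma measurable_gain_powR L x :
  measurable_fun setT (fun tau : measurableTypeR R => gain L (x * tau `^ m)).
Proof.
apply: (measurableT_comp (measurable_gain L)).
by apply: measurable_funM => //; exact: measurable_powR.
Qed.

Lemma lap_step L x : 0 <= x ->
  lap (step L) x = \int[unif]_tau gain L (x * tau `^ m).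
Proof.
move=> x0; apply: EFin_inj; rewrite lapE// integral_mixture; first last.
- by move=> t; rewrite lee_fin expR_ge0.
- by apply/measurable_EFinP; exact: measurable_lap_kernel2.
rewrite EFin_Rintegral_le1; first last.
- by move=> tau; rewrite gain_ge0 gain_le1// mulr_ge0// powR_ge0.
- exact: measurable_gain_powR.
have mlp i : measurable_fun setT
    (fun tau : measurableTypeR R =>
      \int[A i.+1]_a (lap_prod L ((x * tau `^ m)%R, a))%:E)%E.
  apply: (measurable_fun_fubini_tonelli_F
    (fun z : measurableTypeR R * i.+1.-tuple R =>
     (lap_prod L ((x * z.1 `^ m)%R, z.2))%:E)); last first.
    by move=> z; rewrite lee_fin lap_prod_ge0.
  apply/measurable_EFinP; apply: (measurableT_comp (@measurable_lap_prod L i.+1)).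
  apply: measurable_fun_pair => /=; last exact: measurable_snd.
  apply: measurable_funM => //.
  by apply: (measurableT_comp (measurable_powR m)); exact: measurable_fst.
transitivity (\int[unif]_tau \sum_(i < N) (c i)%:E *
    \int[A i.+1]_a (lap_prod L ((x * tau `^ m)%R, a))%:E)%E; last first.
  by apply: eq_integral => tau _; rewrite gainE// mulr_ge0// powR_ge0.
rewrite ge0_integral_sum//; first last.
- move=> i tau _; rewrite mule_ge0 ?lee_fin//.
  by apply: integral_ge0 => a _; rewrite lee_fin lap_prod_ge0.
- by move=> i; apply: emeasurable_funM.
apply: eq_bigr => i _; rewrite ge0_integralZl//; first last.
- by rewrite lee_fin.
- move=> tau _.
  by apply: integral_ge0 => a _; rewrite lee_fin lap_prod_ge0.
congr (_ * _)%E; rewrite -lapE// lap_smear//.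
Qed.

(** Continuity of [step] for pointwise convergence of transforms: bounded convergence over [tau],
    then over [a], then a finite product. *)
Lemma lap_step_cvg (L_ : nat -> probability R R) L x : 0 <= x ->
  (forall y, 0 <= y -> (fun k => lap (L_ k) y) @ \oo --> lap L y) ->
  (fun k => lap (step (L_ k)) x) @ \oo --> lap (step L) x.
Proof.
move=> x0 L_L.
(* With the values abstracted as [v] and [v_], plain rewriting replaces both sides by their integral
   forms. *)
suff H (v : R) (v_ : nat -> R) : v = \int[unif]_tau gain L (x * tau `^ m) ->
    (forall k, v_ k = \int[unif]_tau gain (L_ k) (x * tau `^ m)) ->
    v_ @ \oo --> v.
  exact: (H _ _ (lap_step L x0) (fun k => lap_step (L_ k) x0)).
move=> -> /funext ->; apply: bounded_cvg.
- by move=> k; exact: measurable_gain_powR.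
- exact: measurable_gain_powR.
- by move=> k tau; rewrite gain_ge0 gain_le1// mulr_ge0// powR_ge0.
move=> tau; have : 0 <= x * tau `^ m by rewrite mulr_ge0// powR_ge0.
move: (x * tau `^ m) => y y0.
apply: cvg_big => //; first exact: add_continuous.
move=> i _; apply: cvgMr; apply: bounded_cvg.
- by move=> k; exact: measurable_lap_prod2.
- exact: measurable_lap_prod2.
- by move=> k a; rewrite lap_prod_ge0 lap_prod_le1.
move=> a; apply: cvg_big => //; first exact: mul_continuous.
by move=> j _; apply: L_L; rewrite mulr_ge0.
Qed.

End operator.
(* Otherwise unification unfolds the mixture when comparing two steps. *)
Opaque step.

(** * Moments as averaged differences of the Laplace transform *)

Section power_integrals.
Context (R : realType).
Local Notation leb := (@lebesgue_measure R).

(** Fundamental theorem of calculus with primitive [x^r / r]; [r != 0] excludes the logarithm, and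
    [r] may be negative. *)
Lemma integral_powR_itv (a b r : R) : 0 < a -> a < b -> r != 0 ->
  (\int[leb]_(x in `[a, b]) (x `^ (r - 1))%:E)%E = ((b `^ r - a `^ r) / r)%:E.
Proof.
move=> a0 ab r0.
pose F : R -> R^o := r^-1 \*: (fun y : R => y `^ r : R^o).
have dF (x : R) : 0 < x -> is_derive x 1 F (x `^ (r - 1)).
  move=> x0; have := is_deriveZ (r^-1) (is_derive1_powR r x0).
  by rewrite /GRing.scale/= mulrA mulVf// mul1r.
have cF (x : R) : 0 < x -> {for x, continuous F}.
  move=> x0; apply: differentiable_continuous; apply/derivable1_diffP.
  exact: (ex_derive (is_derive := dF x x0)).
rewrite (continuous_FTC2 (F := F))//.
- by rewrite -EFinB /F /= /GRing.scale/= -mulrBr mulrC.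
- apply: derivable_within_continuous => x; rewrite in_itv/= => /andP[ax _].
  apply: ex_derive; apply: is_derive1_powR; exact: lt_le_trans ax.
- split.
  + move=> x; rewrite in_itv/= => /andP[ax _].
    by apply: (ex_derive (is_derive := dF x _)); exact: lt_trans ax.
  + by apply: cvg_at_right_filter; exact: cF.
  + by apply: cvg_at_left_filter; apply: cF; exact: lt_trans ab.
- move=> x; rewrite in_itv/= => /andP[ax _].
  by rewrite derive1E; apply: (derive_val (is_derive := dF x _)); exact: lt_trans ax.
Qed.

Lemma measurable_powR_E D (r : R) :
  measurable_fun D (fun x : R => (x `^ r)%:E).
Proof. by apply/measurable_EFinP/measurable_funTS; exact: measurable_powR. Qed.

(** With [r = 1 + m s] this is the factor [E U^(m s)]. The exponent [r - 1] may be negative, so the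
    integral is computed away from 0 and then passed to the limit by monotone convergence. *)
Lemma integral_unif_powR (r : R) : 0 < r ->
  (\int[unif R]_tau (tau `^ (r - 1))%R%:E)%E = (r^-1)%:E.
Proof.
move=> r0; rewrite integral_uniform; first last.
- by move=> x; rewrite lee_fin powR_ge0.
- exact: measurable_powR_E.
rewrite subr0 invr1 mul1e -integral_itv_obnd_cbnd; last exact: measurable_powR_E.
(* The left endpoint is [1 / (n + 2)]: with [1 / (n + 1)] the first interval would degenerate to a
   point. *)
pose F n := `[(harmonic n.+1 : R), 1]%classic.
have -> : `]0, 1]%classic = \bigcup_n F n.
  apply/seteqP; split => [x|x [n _]]; rewrite /F /= !in_itv/=; last first.
    by case/andP => hx ->; rewrite andbT (lt_le_trans _ hx)// harmonic_gt0.
  case/andP => x0 x1; exists (Num.truncn x^-1) => //=; rewrite in_itv/= x1 andbT.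
  rewrite /harmonic invf_ple ?posrE//.
  rewrite ltW// (lt_trans (truncnS_gt _))// ltr_nat//.
have := @ge0_nondecreasing_set_cvg_integral _ (measurableTypeR R) R F
  (fun x => (x `^ (r - 1))%:E) leb.
move=> /(_ _ _ _ _)/cvg_lim <-//.
- apply/cvg_lim => //.
  rewrite (_ : (fun n => _) = (fun n => ((1 - harmonic n.+1 `^ r) / r)%:E)).
    apply: cvg_EFin; first exact: nearW.
    suff : (fun n => (1 - (harmonic n.+1 : R) `^ r) / r) @ \oo --> (1 - 0) / r.
      by rewrite subr0 mul1r.
    apply: cvgMl; apply: cvgB; first exact: cvg_cst.
    have /cvg_at_rightP/(_ (fun n => harmonic n.+1)) := powR_cvg0 r0.
    apply; split; first by move=> n; exact: harmonic_gt0.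
    by rewrite (@cvg_shiftS R^o harmonic); exact: cvg_harmonic.
  apply/funext => n; rewrite integral_powR_itv ?harmonic_gt0 ?gt_eqF//.
    by rewrite powR1.
  by rewrite /harmonic invf_lt1// ltr1n.
- move=> i j ij; rewrite subsetEset /F => x /=; rewrite !in_itv/= => /andP[xi ->].
  rewrite andbT (le_trans _ xi)// lef_pV2 ?posrE// ler_nat ltnS ltnS//.
- by move=> i; exact: measurable_itv.
- by move=> i; exact: measurable_powR_E.
- by move=> i x _; rewrite lee_fin powR_ge0.
Qed.

Lemma integral_powR_tail (s : R) : 0 < s ->
  (\int[leb]_(x in `[1%R, +oo[) (x `^ (- s - 1))%:E <= (s^-1)%:E)%E.
Proof.
move=> s0.
pose F n := `[(1 : R), n.+2%:R]%classic.
have -> : `[1, +oo[%classic = \bigcup_n F n.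
  apply/seteqP; split => [x|x [n _]]; rewrite /F /= !in_itv/= ?andbT; last first.
    by case/andP.
  move=> x1; exists (Num.truncn x) => //=; rewrite in_itv/= x1/=.
  by rewrite ltW// (lt_trans (truncnS_gt _))// ltr_nat.
have h : (fun n => \int[leb]_(x in F n) (x `^ (- s - 1))%:E)%E @ \oo -->
    (\int[leb]_(x in \bigcup_n F n) (x `^ (- s - 1))%:E)%E.
  apply: ge0_nondecreasing_set_cvg_integral.
  - move=> i j ij; rewrite subsetEset /F => x /=; rewrite !in_itv/= => /andP[-> xi].
    by rewrite (le_trans xi)// ler_nat !ltnS.
  - by move=> i; exact: measurable_itv.
  - by move=> i; exact: measurable_powR_E.
  - by move=> i x _; rewrite lee_fin powR_ge0.
rewrite -(cvg_lim _ h)//; apply: lime_le; first by apply: cvgP h.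
apply: nearW => n; rewrite integral_powR_itv//; first last.
- by rewrite oppr_eq0 gt_eqF.
- by rewrite ltr1n.
rewrite lee_fin powR1 invrN mulrN -mulNr opprB ler_piMl ?invr_ge0 ?ltW//.
Qed.

(** Lebesgue measure equals [c] times its image under [x -> c x], since the two agree on half-open
    intervals. *)
Lemma integral_scale (c : R) (f : R -> \bar R) : 0 < c ->
  measurable_fun setT f -> (forall x, 0 <= f x)%E ->
  (\int[leb]_x f (c * x)%R = (c^-1)%:E * \int[leb]_x f x)%E.
Proof.
move=> c0 mf f0.
pose phi (x : measurableTypeR R) : measurableTypeR R := c * x.
have mphi : measurable_fun setT phi by apply: measurable_funM.
have ci : 0 <= c by exact: ltW.
have [nu0 nu0E] : exists nu : {measure set (measurableTypeR R) -> \bar R},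
    nu = pushforward leb phi :> (set _ -> _).
  by unshelve eexists (pushforward leb phi).
pose nu : {measure set (measurableTypeR R) -> \bar R} := mscale (NngNum ci) nu0.
have nuE : forall B, measurable B -> leb B = nu B.
  apply: lebesgue_measure_unique => _ [[a b]] _ <-.
  rewrite /nu /= /mscale/= nu0E /pushforward.
  have -> : phi @^-1` `]a, b]%classic = `](a / c), (b / c)]%classic.
    apply/seteqP; split => x; rewrite /= !in_itv/= /phi ltr_pdivrMr//
      ler_pdivlMr// mulrC//.
  rewrite !lebesgue_measure_itv/= !lte_fin ltr_pM2r ?invr_gt0//.
  case: ifPn => _; last by rewrite mule0.
  by rewrite -!EFinB -EFinM; congr EFin; rewrite -mulrBl mulrCA divff ?mulr1 ?gt_eqF.
rewrite [in RHS](eq_measure_integral nu); last by move=> B mB _; exact: nuE.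
rewrite /nu ge0_integral_mscale//= nu0E.
rewrite ge0_integral_pushforward//= muleA -EFinM mulVf ?gt_eqF// mul1e.
by [].
Qed.

End power_integrals.

Lemma integral_indicM d (T : measurableType d) (R : realType)
    (mu : {measure set T -> \bar R}) (D : set T) (f : T -> R) :
  (\int[mu]_x (\1_D x * f x)%:E = \int[mu]_(x in D) (f x)%:E)%E.
Proof.
rewrite [RHS]integral_mkcond; apply: eq_integral => x _.
by rewrite patchE indicE; case: ifPn => _; rewrite ?mul1r ?mul0r.
Qed.

Lemma powRD_gt0 (R : realType) (x r s : R) : 0 < x ->
  x `^ (r + s) = x `^ r * x `^ s.
Proof. by move=> x0; rewrite powRD//; apply/implyP => _; rewrite gt_eqF. Qed.

Section fractional_differences.
Context (R : realType) (s : R) (k : nat).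
Hypothesis s0 : 0 < s.
Hypothesis sk : s + 1 <= k%:R.
Local Notation leb := (@lebesgue_measure R).

(** Extension by zero to the whole line lets the change of variables proceed without tracking a
    domain. *)
Definition diff_weight (x : R) : R := \1_`]0, +oo[%classic x * x `^ (- s - 1).

Definition diff_kernel (x t : R) : R :=
  diff_weight x * (1 - expR (- (x * `|t|))) ^+ k.

Lemma diff_weight_ge0 x : 0 <= diff_weight x.
Proof. by rewrite mulr_ge0// ?powR_ge0// indicE. Qed.

Lemma diff_weight_le0 x : x <= 0 -> diff_weight x = 0.
Proof.
by move=> x0; rewrite /diff_weight indicE memNset ?mul0r//= in_itv/= ltNge x0.
Qed.

Lemma diff_weight_gt0 x : 0 < x -> diff_weight x = x `^ (- s - 1).
Proof.
by move=> x0; rewrite /diff_weight indicE mem_set ?mul1r//= in_itv/= x0.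
Qed.

Lemma diff_base_ge0 (x t : R) : 0 <= x -> 0 <= 1 - expR (- (x * `|t|)).
Proof. by move=> x0; rewrite subr_ge0 expRN_le1. Qed.

Lemma diff_base_le1 (x t : R) : 1 - expR (- (x * `|t|)) <= 1.
Proof. by rewrite lerBlDr lerDl expR_ge0. Qed.

Lemma diff_kernel_ge0 x t : 0 <= diff_kernel x t.
Proof.
rewrite /diff_kernel; have [x0|x0] := leP x 0.
  by rewrite diff_weight_le0// mul0r.
by rewrite mulr_ge0 ?diff_weight_ge0// exprn_ge0// diff_base_ge0// ltW.
Qed.

Lemma measurable_diff_weight : measurable_fun setT diff_weight.
Proof.
apply: measurable_funM; last exact: measurable_powR.
exact: measurable_indic.
Qed.

Lemma measurable_diff_kernel :
  measurable_fun setT (fun z : measurableTypeR R * R => diff_kernel z.1 z.2).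
Proof.
apply: measurable_funM.
  exact: (measurableT_comp measurable_diff_weight measurable_fst).
apply: measurable_funX; apply: measurable_funB => //.
exact: measurable_lap_kernel.
Qed.

Lemma measurable_diff_kernel1 t :
  measurable_fun setT (fun x : measurableTypeR R => diff_kernel x t).
Proof. exact: (measurableT_comp measurable_diff_kernel (measurable_pair2 t)). Qed.

Definition diff_const : \bar R := (\int[leb]_x (diff_kernel x 1)%:E)%E.

Lemma order_gt0 : (0 < k)%N.
Proof.
by rewrite -(@ltr_nat R) (lt_le_trans _ sk)// ltr_wpDr.
Qed.

Lemma integral_diff_kernel t :
  (\int[leb]_x (diff_kernel x t)%:E = (`|t| `^ s)%:E * diff_const)%E.
Proof.
have [->|t0] := eqVneq t 0.
  rewrite normr0 powR0 ?gt_eqF// mul0e integral0_eq// => x _.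
  rewrite /diff_kernel normr0 mulr0 oppr0 expR0 subrr expr0n.
  by rewrite gtn_eqF ?order_gt0// mulr0.
have {}t0 : 0 < `|t| by rewrite normr_gt0.
transitivity (\int[leb]_x ((`|t| `^ (s + 1))%:E * (diff_kernel (`|t| * x)%R 1)%:E))%E.
  apply: eq_integral => x _; rewrite -EFinM /diff_kernel mulrA; congr EFin.
  congr (_ * _ ^+ _); last by rewrite normr1 mulr1 mulrC.
  have [x0|x0] := leP x 0.
    by rewrite !diff_weight_le0 ?mulr0// pmulr_rle0.
  rewrite !diff_weight_gt0 ?mulr_gt0// powRM ?ltW// mulrA.
  rewrite -powRD_gt0//.
  by rewrite (_ : s + 1 + (- s - 1) = 0) ?powRr0 ?mul1r// -opprD subrr.
rewrite (ge0_integralZl _ measurableT); first last.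
- by rewrite lee_fin powR_ge0.
- by move=> x _; rewrite lee_fin diff_kernel_ge0.
- apply/measurable_EFinP.
  apply: (measurableT_comp (measurable_diff_kernel1 1)).
  exact: measurable_funM.
rewrite (integral_scale (f := fun x => (diff_kernel x 1)%:E))//; first last.
- by move=> x; rewrite lee_fin diff_kernel_ge0.
- by apply/measurable_EFinP; exact: measurable_diff_kernel1.
rewrite muleA -EFinM; congr (EFin _ * _)%E.
by rewrite powRD_gt0// powRr1 ?ltW// -mulrA mulfV ?gt_eqF// mulr1.
Qed.

(** On []0, 1]] the bound [1 - e^(-x) <= x] and [k >= s + 1] keep the kernel below 1; beyond 1 it is
    below the integrable [x^(-s-1)]. *)
Lemma diff_const_lty : (diff_const < +oo)%E.
Proof.
have m1 : measurable_fun setT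
    (fun x : measurableTypeR R => \1_`[0, 1]%classic x : R).
  exact: measurable_indic.
have m2 : measurable_fun setT
    (fun x : measurableTypeR R => \1_`[1, +oo[%classic x * x `^ (- s - 1)).
  by apply: measurable_funM; [exact: measurable_indic|exact: measurable_powR].
apply: (@le_lt_trans _ _ (\int[leb]_x (\1_`[0%R, 1%R]%classic x +
    \1_`[1%R, +oo[%classic x * x `^ (- s - 1))%R%:E)%E).
  apply: ge0_le_integralE => //.
  - exact: measurable_diff_kernel1.
  - exact: measurable_funD.
  - by move=> x; exact: diff_kernel_ge0.
  move=> x; rewrite /diff_kernel normr1 mulr1.
  have [x0|x0] := leP x 0.
    by rewrite diff_weight_le0// mul0r addr_ge0// ?mulr_ge0 ?powR_ge0// indicE.
  rewrite diff_weight_gt0//.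
  have b0 := diff_base_ge0 1 (ltW x0); have b1 := diff_base_le1 x 1.
  rewrite normr1 mulr1 in b0 b1.
  have [x1|x1] := leP x 1.
    apply: (@le_trans _ _ 1); last first.
      rewrite indicE mem_set/= ?in_itv/= ?(ltW x0) ?x1// lerDl.
      by rewrite mulr_ge0 ?powR_ge0// indicE.
    apply: (@le_trans _ _ (x `^ (- s - 1) * x ^+ k)).
      rewrite ler_wpM2l ?powR_ge0// lerXn2r ?nnegrE ?(ltW x0)//.
      by rewrite lerBlDr -lerBlDl expR_ge1Dx.
    rewrite -powR_mulrn ?(ltW x0)// -powRD_gt0//.
    (* The bound 1 is written as a power of 1, so that monotonicity in the base applies. *)
    rewrite -[leRHS](congr1 (fun f => f (- s - 1 + k%:R)) (powR1 R)).
    rewrite ge0_ler_powR ?nnegrE ?(ltW x0)//.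
    by rewrite -opprD addrC subr_ge0.
  apply: (@le_trans _ _ (x `^ (- s - 1))).
    by rewrite ler_piMr ?powR_ge0// exprn_ile1.
  rewrite [X in _ + X * _]indicE mem_set/= ?in_itv/= ?andbT ?(ltW x1)// mul1r lerDr.
  by rewrite indicE.
under eq_integral do rewrite EFinD.
rewrite ge0_integralD//; first last.
- exact/measurable_EFinP.
- by move=> x _; rewrite lee_fin mulr_ge0 ?powR_ge0// indicE.
- exact/measurable_EFinP.
rewrite integral_indic// setIT integral_indicM; apply: lte_add_pinfty.
  by rewrite /= lebesgue_measure_itv/= lte_fin ltr01 oppr0 adde0 ltry.
by apply: (le_lt_trans (integral_powR_tail s0)); exact: ltry.
Qed.

Lemma diff_const_gt0 : (0 < diff_const)%E.
Proof.
(* Lower bound of the kernel on [[1, 2]]: the weight decreases, so it is taken at 2; the difference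
   increases, so it is taken at 1. *)
pose c0 : R := 2 `^ (- s - 1) * (1 - expR (- 1)) ^+ k.
have c00 : 0 < c0.
  by rewrite mulr_gt0 ?powR_gt0// exprn_gt0// subr_gt0 expR_lt1 ltrN10.
apply: (@lt_le_trans _ _ (\int[leb]_x (\1_`[1%R, 2%R]%classic x * c0)%R%:E)%E).
  rewrite integral_indicM integral_cst//= lebesgue_measure_itv/= lte_fin ltr1n/=.
  by rewrite -EFinB -EFinM lte_fin mulr_gt0// subr_gt0 ltr1n.
apply: ge0_le_integralE => //.
- by apply: measurable_funM => //; exact: measurable_indic.
- exact: measurable_diff_kernel1.
- by move=> x; rewrite mulr_ge0 ?(ltW c00)// indicE.
move=> x; rewrite indicE; have [|] := boolP (x \in _); last first.
  by rewrite mul0r diff_kernel_ge0.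
rewrite inE/= in_itv/= => /andP[x1 x2]; rewrite mul1r /diff_kernel.
have x0 : 0 < x by exact: lt_le_trans x1.
rewrite diff_weight_gt0// normr1 mulr1 /c0; apply: ler_pM.
- exact: powR_ge0.
- by rewrite exprn_ge0// subr_ge0 expR_le1 oppr_le0.
- rewrite -opprD !powRN lef_pV2 ?posrE ?powR_gt0//.
  by rewrite ge0_ler_powR ?nnegrE ?addr_ge0 ?(ltW s0) ?(ltW x0).
rewrite lerXn2r ?nnegrE ?subr_ge0 ?expR_le1 ?oppr_le0 ?(ltW x0)//.
by rewrite lerB// ler_expR lerN2.
Qed.

End fractional_differences.

(** * Lower semicontinuity of moments under convergence of transforms *)

Section lower_semicontinuity.
Context (R : realType).
Local Notation leb := (@lebesgue_measure R).

(** Up to sign, the [k]-th difference of [lap L] with increment [x] at the point [y]. A general base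
    point is what allows the recursion on [k]. *)
Definition lap_diff k (y x : R) (L : probability R R) : R :=
  \int[L]_t (expR (- (y * `|t|)) * (1 - expR (- (x * `|t|))) ^+ k).

Lemma measurable_lap_diff_kernel k (y x : R) : measurable_fun setT
  (fun t : R => expR (- (y * `|t|)) * (1 - expR (- (x * `|t|))) ^+ k).
Proof.
apply: measurable_funM; first exact: measurable_lap_kernel2.
apply: measurable_funX; apply: measurable_funB => //.
exact: measurable_lap_kernel2.
Qed.

Lemma lap_diff_kernel_itv k (y x t : R) : 0 <= y -> 0 <= x ->
  0 <= expR (- (y * `|t|)) * (1 - expR (- (x * `|t|))) ^+ k <= 1.
Proof.
move=> y0 x0; have b0 := diff_base_ge0 t x0.
rewrite mulr_ge0 ?expR_ge0 ?exprn_ge0//=.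
rewrite -[leRHS]mulr1 ler_pM ?expR_ge0 ?exprn_ge0 ?expRN_le1//.
by rewrite exprn_ile1// diff_base_le1.
Qed.

Lemma lap_diff_integrable k (y x : R) (L : probability R R) : 0 <= y -> 0 <= x ->
  L.-integrable setT (EFin \o
    (fun t : R => expR (- (y * `|t|)) * (1 - expR (- (x * `|t|))) ^+ k)).
Proof.
move=> y0 x0; apply: measurable_bounded_integrable => //.
- by rewrite [X in (X < _)%E]probability_setT ltry.
- exact: measurable_lap_diff_kernel.
exists 1; split => // M M1 t _ /=.
have /andP[k0 k1] := lap_diff_kernel_itv k t y0 x0.
by rewrite ger0_norm// (le_trans k1)// ltW.
Qed.

Lemma lap_diffS k (y x : R) L : 0 <= y -> 0 <= x ->
  lap_diff k.+1 y x L = lap_diff k y x L - lap_diff k (y + x) x L.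
Proof.
move=> y0 x0; rewrite /lap_diff -RintegralB//; first last.
- by apply: lap_diff_integrable => //; rewrite addr_ge0.
- exact: lap_diff_integrable.
congr fine; apply: eq_integral => t _; congr EFin.
rewrite exprS mulrA -mulrBl; congr (_ * _).
by rewrite mulrBr mulr1 mulrDl opprD expRD.
Qed.

(** By [lap_diffS] a difference is a finite combination of values of the transform, so it converges
    with them. *)
Lemma lap_diff_cvg (L_ : nat -> probability R R) L :
  (forall y, 0 <= y -> (fun m => lap (L_ m) y) @ \oo --> lap L y) ->
  forall k y x, 0 <= y -> 0 <= x ->
  (fun m => lap_diff k y x (L_ m)) @ \oo --> lap_diff k y x L.
Proof.
move=> L_L; elim=> [|k IH] y x y0 x0.
  have e L' : lap_diff 0 y x L' = lap L' y.
    by congr fine; apply: eq_integral => t _; rewrite expr0 mulr1.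
  by rewrite e (funext (fun m => e (L_ m))); exact: L_L.
rewrite lap_diffS// (funext (fun m => lap_diffS k (L_ m) y0 x0)).
by apply: cvgB; apply: IH; rewrite ?addr_ge0.
Qed.

Lemma limn_einf_le (u : nat -> \bar R) (M : \bar R) :
  (forall n, u n <= M)%E -> (limn_einf u <= M)%E.
Proof.
move=> uM; rewrite limn_einf_lim; apply: lime_le; first exact: is_cvg_einfs.
apply: nearW => n; apply: (le_trans _ (uM n)).
by apply: ereal_inf_lbound; exists n => //=.
Qed.

Variables (s : R) (k : nat).
Hypothesis s0 : 0 < s.
Hypothesis sk : s + 1 <= k%:R.

(** As an integral of the joint kernel the product gets its sign and its measurability in [x]; for
    [x <= 0] the weight kills both sides. *)
Lemma lap_diff_weightE L x : ((diff_weight s x * lap_diff k 0 x L)%:E =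
  \int[L]_t (diff_kernel s k x t)%:E)%E.
Proof.
rewrite /diff_kernel; have [x0|x0] := leP x 0.
  rewrite diff_weight_le0// mul0r integral0_eq// => t _.
  by rewrite mul0r.
rewrite EFinM EFin_Rintegral_le1; first last.
- by move=> t; exact: lap_diff_kernel_itv (ltW x0).
- exact: measurable_lap_diff_kernel.
rewrite -(ge0_integralZl _ measurableT); first last.
- by rewrite lee_fin diff_weight_ge0.
- move=> t _; rewrite lee_fin.
  by have /andP[] := lap_diff_kernel_itv k t (lexx 0) (ltW x0).
- by apply/measurable_EFinP; exact: measurable_lap_diff_kernel.
by apply: eq_integral => t _; rewrite mul0r oppr0 expR0 mul1r EFinM.
Qed.

Lemma measurable_lap_diff_weight L : measurable_fun setT
  (fun x : measurableTypeR R => (diff_weight s x * lap_diff k 0 x L)%:E).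
Proof.
rewrite (funext (lap_diff_weightE L)).
apply: (measurable_fun_fubini_tonelli_F
  (fun z : measurableTypeR R * R => (diff_kernel s k z.1 z.2)%:E)).
  by apply/measurable_EFinP; exact: measurable_diff_kernel.
by move=> z; rewrite lee_fin diff_kernel_ge0.
Qed.

(* Tonelli: the moment is an average of the k-th differences at 0 of the
   Laplace transform. *)
Lemma mom_lap_diff L : (diff_const s k * mom s L =
  \int[leb]_x (diff_weight s x * lap_diff k 0 x L)%:E)%E.
Proof.
rewrite /mom -(ge0_integralZl _ measurableT); first last.
- exact/ltW/diff_const_gt0.
- by move=> t _; rewrite lee_fin powR_ge0.
- by apply/measurable_EFinP; exact: measurable_powRn.
transitivity (\int[L]_t \int[leb]_x (diff_kernel s k x t)%:E)%E.
  by apply: eq_integral => t _; rewrite integral_diff_kernel// muleC.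
rewrite -(fubini_tonelli (m1 := leb) (m2 := L)
  (fun z : measurableTypeR R * R => (diff_kernel s k z.1 z.2)%:E))/=; first last.
- by move=> z; rewrite lee_fin diff_kernel_ge0.
- by apply/measurable_EFinP; exact: measurable_diff_kernel.
by apply: eq_integral => x _; rewrite lap_diff_weightE.
Qed.

(** Fatou's lemma in the formula [mom_lap_diff], whose constant is positive and finite and hence
    cancels. *)
Lemma mom_lsc (L_ : nat -> probability R R) L (B : R) :
  (forall y, 0 <= y -> (fun m => lap (L_ m) y) @ \oo --> lap L y) ->
  (forall m, mom s (L_ m) <= B%:E)%E -> (mom s L <= B%:E)%E.
Proof.
move=> L_L LB.
have C0 := diff_const_gt0 k s0; have Coo := diff_const_lty s0 sk.
rewrite -(lee_pmul2l _ C0) ?ge0_fin_numE ?(ltW C0)//.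
rewrite mom_lap_diff.
pose f m x := (diff_weight s x * lap_diff k 0 x (L_ m))%:E.
have -> : (\int[leb]_x (diff_weight s x * lap_diff k 0 x L)%:E =
    \int[leb]_x limn_einf (f ^~ x))%E.
  apply: eq_integral => x _; apply/esym/(cvg_limn_einf_sup _).1.
  apply: cvg_EFin; first exact: nearW.
  have [x0|x0] := leP x 0.
    rewrite /f diff_weight_le0// mul0r.
    by under eq_fun do rewrite mul0r; exact: cvg_cst.
  by apply: cvgMr; apply: lap_diff_cvg => //; exact: ltW.
apply: (le_trans (fatou leb measurableT (f := f) _ _)).
- by move=> m; exact: measurable_lap_diff_weight.
- move=> m x _; rewrite /f lap_diff_weightE; apply: integral_ge0 => t _.
  by rewrite lee_fin diff_kernel_ge0.
apply: limn_einf_le => m; rewrite -mom_lap_diff.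
by rewrite lee_pmul2l// ge0_fin_numE// ltW.
Qed.

End lower_semicontinuity.

(** * Moment recurrence *)

Section power_inequalities.
Context (R : realType).
Implicit Types (s x y : R).

(** The convention [0^0 = 1] would break the identity at [x = 0] if [s] were 0. *)
Lemma powRS x s : 0 <= x -> s != 0 -> x `^ s = x * x `^ (s - 1).
Proof.
move=> x0 s0; have [->|xn0] := eqVneq x 0; first by rewrite powR0// mul0r.
have {xn0} x0' : 0 < x by rewrite lt_neqAle eq_sym xn0.
by rewrite -[X in X * _](powRr1 x0) -powRD_gt0// addrC subrK.
Qed.

(** Young's inequality for the product [x * 1] with exponent [s] and its conjugate
    [(1 - 1/s)^(-1)]. *)
Lemma powR_young x s : 0 <= x -> 1 < s -> x <= x `^ s / s + (1 - s^-1).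
Proof.
move=> x0 s1; have s0 : 0 < s by exact: lt_trans s1.
have s1' : 0 < 1 - s^-1 by rewrite subr_gt0 invf_lt1.
have := @conjugate_powR R x 1 s (1 - s^-1)^-1 x0 ler01 s0.
rewrite invr_gt0 invrK => /(_ s1'); rewrite addrC subrK => /(_ erefl).
by rewrite mulr1 powR1 mul1r.
Qed.

(** Convexity: the power function lies above its tangent at [x]. For [x > 0] this is [powR_young] at
    [y / x], multiplied by [s x^s]. *)
Lemma powR_bernoulli x y s : 1 < s -> 0 <= y -> y <= x ->
  x `^ s <= y `^ s + s * x `^ (s - 1) * (x - y).
Proof.
move=> s1 y0 yx; have s0 : 0 < s by exact: lt_trans s1.
have [x0|x0] := leP x 0.
  have xE : x = 0 by apply/eqP; rewrite eq_le x0 (le_trans y0 yx).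
  have yE : y = 0 by apply/eqP; rewrite eq_le y0 (le_trans yx x0).
  by rewrite xE yE subrr mulr0 addr0.
have t0 : 0 <= y / x by rewrite divr_ge0// ltW.
have h1 : s * (y / x) <= (y / x) `^ s + (s - 1).
  have := powR_young t0 s1; rewrite -(ler_pM2l s0) mulrDr mulrBr mulr1.
  by rewrite mulrC mulrCA mulfV ?gt_eqF// mulr1.
have h2 : (y / x) `^ s * x `^ s = y `^ s.
  by rewrite -powRM ?(ltW x0)// mulfVK ?gt_eqF.
have h3 : x `^ s = x * x `^ (s - 1) by apply: powRS; rewrite ?gt_eqF ?ltW.
have h4 : (y / x) * x `^ s = y * x `^ (s - 1).
  by rewrite h3 mulrA mulfVK ?gt_eqF.
have h5 : s * (y / x) * x `^ s = s * (y * x `^ (s - 1)) by rewrite -mulrA h4.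
have := ler_wpM2r (powR_ge0 x s) h1; rewrite mulrDl h2 h5 h3.
by move: (x `^ (s - 1)) (y `^ s) => X Y; nra.
Qed.

(** With [S] the sum, [S^s] is the sum of the [y_i S^(s-1)], and each [y_i] is at most [S]. *)
Lemma sum_powR_le n (y : 'I_n -> R) s : 1 < s -> (forall i, 0 <= y i) ->
  \sum_i y i `^ s <= (\sum_i y i) `^ s.
Proof.
move=> s1 y0; have s0 : 0 < s by exact: lt_trans s1.
rewrite (@powRS (\sum_i y i)) ?sumr_ge0 ?gt_eqF// mulr_suml.
apply: ler_sum => i _; rewrite powRS ?gt_eqF// ler_wpM2l//.
rewrite ge0_ler_powR ?nnegrE ?sumr_ge0//; first by rewrite subr_ge0 ltW.
by rewrite (bigD1 i)//= lerDl sumr_ge0.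
Qed.

(** Same splitting; the term of index [j] is strict because [y_k > 0] gives [y_j < S]. *)
Lemma sum_powR_lt n (y : 'I_n -> R) s (j k : 'I_n) : 1 < s ->
  (forall i, 0 <= y i) -> j != k -> 0 < y j -> 0 < y k ->
  \sum_i y i `^ s < (\sum_i y i) `^ s.
Proof.
move=> s1 y0 jk yj yk; have s0 : 0 < s by exact: lt_trans s1.
rewrite (@powRS (\sum_i y i)) ?sumr_ge0 ?gt_eqF// mulr_suml.
have le_S i : y i <= \sum_i y i by rewrite (bigD1 i)//= lerDl sumr_ge0.
rewrite (bigD1 j)//= [ltRHS](bigD1 j)//=; apply: ltr_leD; last first.
  apply: ler_sum => i _; rewrite powRS ?gt_eqF// ler_wpM2l//.
  by rewrite ge0_ler_powR ?nnegrE ?sumr_ge0// subr_ge0 ltW.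
rewrite powRS ?gt_eqF// ltr_pM2l// gt0_ltr_powR ?nnegrE ?sumr_ge0 ?subr_gt0//.
rewrite (bigD1 j)//= ltrDl (bigD1 k)/= 1?eq_sym// ltr_wpDr// sumr_ge0//.
Qed.

(** The tangent inequality between the sum [S] and the largest term [y_M]: the increment [S - y_M]
    is the sum of the other terms, and [S <= (n + 1) y_M] turns [S^(s-1)] into a multiple of
    [y_M^(s-1)]. *)
Lemma powR_sum_le n (y : 'I_n.+1 -> R) s : 1 < s -> (forall i, 0 <= y i) ->
  (\sum_i y i) `^ s <= \sum_i y i `^ s +
    s * n.+1%:R `^ (s - 1) * \sum_j \sum_(k | k != j) y j `^ (s - 1) * y k.
Proof.
move=> s1 y0; have s0 : 0 < s by exact: lt_trans s1.
pose M := [arg max_(i > ord0) y i]%O.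
have yM i : y i <= y M.
  by rewrite /M; case: Order.TotalTheory.arg_maxP => // m _ h; exact: h.
set S := \sum_i y i.
have SM : S <= n.+1%:R * y M.
  have -> : n.+1%:R * y M = \sum_(i < n.+1) y M.
    by rewrite sumr_const card_ord mulr_natl.
  by apply: ler_sum => i _; exact: yM.
have SE : S - y M = \sum_(k | k != M) y k.
  by rewrite /S (bigD1 M)//= addrC addrK.
have yMS : y M <= S by rewrite -subr_ge0 SE sumr_ge0.
have C0 : 0 <= s * n.+1%:R `^ (s - 1) by rewrite mulr_ge0 ?powR_ge0// ltW.
apply: (le_trans (powR_bernoulli s1 (y0 M) yMS)).
apply: lerD; first by rewrite (bigD1 M)//= lerDl sumr_ge0// => i _; exact: powR_ge0.
apply: (@le_trans _ _ (s * n.+1%:R `^ (s - 1) *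
    \sum_(k | k != M) y M `^ (s - 1) * y k)).
  rewrite SE -!mulrA ler_wpM2l ?(ltW s0)// -mulr_sumr mulrA ler_wpM2r ?sumr_ge0//.
  rewrite -powRM// ge0_ler_powR ?nnegrE ?mulr_ge0 ?sumr_ge0//.
  by rewrite subr_ge0 ltW.
rewrite ler_wpM2l// [leRHS](bigD1 M)//= lerDl sumr_ge0// => i _.
by rewrite sumr_ge0// => k _; rewrite mulr_ge0 ?powR_ge0.
Qed.

End power_inequalities.

Lemma integral_sumE d (T : measurableType d) (R : realType)
    (mu : {measure set T -> \bar R}) (I : Type) (r : seq I) (p : pred I)
    (f : I -> T -> R) :
  (forall i, measurable_fun setT (f i)) -> (forall i x, 0 <= f i x) ->
  (\int[mu]_x (\sum_(i <- r | p i) f i x)%:E =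
   \sum_(i <- r | p i) \int[mu]_x (f i x)%:E)%E.
Proof.
move=> mf f0; rewrite -big_filter.
under eq_integral do rewrite -big_filter -sumEFin.
rewrite ge0_integral_sum//.
- by move=> i; apply/measurable_EFinP.
- by move=> i x _; rewrite lee_fin.
Qed.

Lemma measurable_sum_cond d (T : measurableType d) (R : realType) (I : Type)
    (r : seq I) (p : pred I) (f : I -> T -> R) :
  (forall i, measurable_fun setT (f i)) ->
  measurable_fun setT (fun x => \sum_(i <- r | p i) f i x).
Proof.
move=> mf; under eq_fun do rewrite -big_filter.
exact: measurable_sum.
Qed.

Lemma integral_prodM d d' (T : measurableType d) (T' : measurableType d')
    (R : realType) (P : probability T R) (Q : probability T' R)
    (f : T -> R) (g : T' -> R) :
  measurable_fun setT f -> measurable_fun setT g ->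
  (forall x, 0 <= f x) -> (forall x, 0 <= g x) ->
  (\int[P \x Q]_z (f z.1 * g z.2)%:E =
   \int[P]_x (f x)%:E * \int[Q]_y (g y)%:E)%E.
Proof.
move=> mf mg f0 g0; rewrite fubini_tonelli1; first last.
- by move=> z; rewrite lee_fin mulr_ge0.
- apply/measurable_EFinP; apply: measurable_funM.
    exact: (measurableT_comp mf measurable_fst).
  exact: (measurableT_comp mg measurable_snd).
rewrite -(ge0_integralZr _ measurableT); first last.
- by apply: integral_ge0 => y _; rewrite lee_fin.
- by move=> x _; rewrite lee_fin.
- exact/measurable_EFinP.
apply: eq_integral => x _; rewrite -(ge0_integralZl _ measurableT)//.
- exact/measurable_EFinP.
- by move=> y _; rewrite lee_fin.
- by rewrite lee_fin.
Qed.

Section power_coordinates.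
Context d (T : measurableType d) (R : realType) (L : probability T R) (n : nat).

(** The product formula with the factor 1 at every other coordinate. *)
Lemma integral_power_coord (j : 'I_n) (f : T -> R) :
  measurable_fun setT f -> (forall x, 0 <= f x) ->
  (\int[power L n]_v (f (tnth v j))%:E = \int[L]_x (f x)%:E)%E.
Proof.
move=> mf f0; pose h (i : 'I_n) x := if i == j then f x else 1.
transitivity (\int[power L n]_v (\prod_(i < n) h i (tnth v i))%:E)%E.
  apply: eq_integral => v _; congr EFin.
  rewrite (bigD1 j)//= /h eqxx big1 ?mulr1// => i /negbTE ->//.
rewrite integral_power_prod; first last.
- by move=> i x; rewrite /h; case: ifP.
- by move=> i; rewrite /h; case: (i == j).
rewrite (bigD1 j)//= big1 ?mule1; last first.
  by move=> i /negbTE ij; rewrite /h ij prob_integral_cst.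
by rewrite /h eqxx.
Qed.

Lemma integral_power_coord2 (j k : 'I_n) (f g : T -> R) : k != j ->
  measurable_fun setT f -> (forall x, 0 <= f x) ->
  measurable_fun setT g -> (forall x, 0 <= g x) ->
  (\int[power L n]_v (f (tnth v j) * g (tnth v k))%:E =
   \int[L]_x (f x)%:E * \int[L]_x (g x)%:E)%E.
Proof.
move=> kj mf f0 mg g0.
pose h (i : 'I_n) x := if i == j then f x else if i == k then g x else 1.
transitivity (\int[power L n]_v (\prod_(i < n) h i (tnth v i))%:E)%E.
  apply: eq_integral => v _; congr EFin.
  rewrite (bigD1 j)//= /h eqxx (bigD1 k)//= (negbTE kj) eqxx big1 ?mulr1//.
  by move=> i /andP[/negbTE -> /negbTE ->].
rewrite integral_power_prod; first last.
- by move=> i x; rewrite /h; case: ifP => // _; case: ifP.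
- by move=> i; rewrite /h; case: (i == j) => //; case: (i == k).
rewrite (bigD1 j)//= (bigD1 k)//= big1 ?mule1; last first.
  by move=> i /andP[/negbTE ij /negbTE ik]; rewrite /h ij ik prob_integral_cst.
by rewrite /h eqxx (negbTE kj) eqxx.
Qed.

End power_coordinates.

Section weighted_sum_moments.
Context (R : realType) (n : nat) (A : probability (n.-tuple R) R)
  (L : probability R R) (s : R).
Hypothesis s1 : 1 < s.
Local Notation Q := (A \x power L n)%E.

Let s0 : 0 < s. Proof. exact: lt_trans s1. Qed.

Lemma measurable_tnth_normr (j : 'I_n) :
  measurable_fun setT (fun a : n.-tuple R => `|tnth a j|).
Proof. by apply: measurableT_comp => //; exact: measurable_tnth. Qed.

Lemma measurable_tnth_powR r (j : 'I_n) :
  measurable_fun setT (fun a : n.-tuple R => `|tnth a j| `^ r).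
Proof.
apply: (measurableT_comp (measurable_powR r)); exact: measurable_tnth_normr.
Qed.

Lemma measurable_sum_tnth_powR :
  measurable_fun setT (fun z : n.-tuple R * n.-tuple R =>
    \sum_(j < n) (`|tnth z.1 j| * `|tnth z.2 j|) `^ s).
Proof.
apply: measurable_sum => j; apply: (measurableT_comp (measurable_powR s)).
apply: measurable_funM.
  exact: (measurableT_comp (measurable_tnth_normr j) measurable_fst).
exact: (measurableT_comp (measurable_tnth_normr j) measurable_snd).
Qed.

(** For a symmetric [A] this is [n] times the [s]-th moment of the first coordinate, that is, what
    [A] contributes to lambda before weighting. *)
Definition diag : \bar R := (\int[A]_a (\sum_(j < n) `|tnth a j| `^ s)%:E)%E.

Definition offdiag : \bar R := (\int[A]_a
  (\sum_(j < n) \sum_(k < n | k != j) `|tnth a j| `^ (s - 1) * `|tnth a k|)%:E)%E.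

Lemma integral_diag :
  (\int[Q]_z (\sum_(j < n) (`|tnth z.1 j| * `|tnth z.2 j|) `^ s)%:E =
   diag * mom s L)%E.
Proof.
rewrite /diag !integral_sumE; first last.
- by move=> j z; exact: powR_ge0.
- move=> j; apply: (measurableT_comp (measurable_powR s)).
  apply: measurable_funM.
    exact: (measurableT_comp (measurable_tnth_normr j) measurable_fst).
  exact: (measurableT_comp (measurable_tnth_normr j) measurable_snd).
- by move=> j z; exact: powR_ge0.
- exact: measurable_tnth_powR.
rewrite ge0_sume_distrl; last first.
  by move=> j _; apply: integral_ge0 => a _; rewrite lee_fin powR_ge0.
apply: eq_bigr => j _.
under eq_integral do rewrite powRM//.
rewrite (integral_prodM A (power L n) (f := fun a : n.-tuple R => `|tnth a j| `^ s)
  (g := fun a : n.-tuple R => `|tnth a j| `^ s)); first last.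
- by move=> v; exact: powR_ge0.
- by move=> v; exact: powR_ge0.
- exact: measurable_tnth_powR.
- exact: measurable_tnth_powR.
congr (_ * _)%E; rewrite (integral_power_coord L j (f := fun t => `|t| `^ s))//.
exact: measurable_powRn.
Qed.

Lemma diag_le : (diag * mom s L <= \int[Q]_z (wsum z `^ s)%:E)%E.
Proof.
rewrite -integral_diag; apply: ge0_le_integralE.
- exact: measurable_sum_tnth_powR.
- by apply: (measurableT_comp (measurable_powR s)); exact: measurable_wsum.
- by move=> z; apply: sumr_ge0 => j _; exact: powR_ge0.
- by move=> z; apply: sum_powR_le => // j; rewrite mulr_ge0.
Qed.

Lemma integral_offdiag :
  (\int[Q]_z (\sum_(j < n) \sum_(k < n | k != j)
     (`|tnth z.1 j| * `|tnth z.2 j|) `^ (s - 1) *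
     (`|tnth z.1 k| * `|tnth z.2 k|))%:E =
   offdiag * (mom (s - 1) L * mom 1 L))%E.
Proof.
have mc (j k : 'I_n) : measurable_fun setT
    (fun a : n.-tuple R => `|tnth a j| `^ (s - 1) * `|tnth a k|).
  apply: measurable_funM; first exact: measurable_tnth_powR.
  exact: measurable_tnth_normr.
have c0 (j k : 'I_n) (a : n.-tuple R) : 0 <= `|tnth a j| `^ (s - 1) * `|tnth a k|.
  by rewrite mulr_ge0 ?powR_ge0.
transitivity (\int[Q]_z (\sum_(j < n) \sum_(k < n | k != j)
   (`|tnth z.1 j| `^ (s - 1) * `|tnth z.1 k|) *
   (`|tnth z.2 j| `^ (s - 1) * `|tnth z.2 k|))%:E)%E.
  apply: eq_integral => z _; congr EFin; apply: eq_bigr => j _.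
  by apply: eq_bigr => k _; rewrite powRM// mulrACA.
have mc2 (j k : 'I_n) : measurable_fun setT (fun z : n.-tuple R * n.-tuple R =>
   (`|tnth z.1 j| `^ (s - 1) * `|tnth z.1 k|) *
   (`|tnth z.2 j| `^ (s - 1) * `|tnth z.2 k|)).
  apply: measurable_funM.
    exact: (measurableT_comp (mc j k) measurable_fst).
  exact: (measurableT_comp (mc j k) measurable_snd).
rewrite /offdiag !integral_sumE; first last.
- by move=> j z; apply: sumr_ge0 => k _; rewrite mulr_ge0.
- by move=> j; exact: measurable_sum_cond.
- by move=> j z; apply: sumr_ge0.
- by move=> j; exact: measurable_sum_cond.
rewrite ge0_sume_distrl; last first.
  by move=> j _; apply: integral_ge0 => a _; rewrite lee_fin sumr_ge0.
apply: eq_bigr => j _.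
rewrite !integral_sumE//.
rewrite ge0_sume_distrl; last first.
  by move=> k _; apply: integral_ge0 => a _; rewrite lee_fin.
apply: eq_bigr => k kj.
rewrite (integral_prodM A (power L n)
  (f := fun a : n.-tuple R => `|tnth a j| `^ (s - 1) * `|tnth a k|)
  (g := fun a : n.-tuple R => `|tnth a j| `^ (s - 1) * `|tnth a k|))//.
congr (_ * _)%E; rewrite (integral_power_coord2 L (f := fun t => `|t| `^ (s - 1))
  (g := fun t => `|t|) kj)//.
- congr (_ * _)%E; apply: eq_integral => t _; by rewrite powRr1.
- exact: measurable_powRn.
Qed.

End weighted_sum_moments.

(** Integrates [powR_sum_le]. By independence each cross term splits into a coefficient of [A] and
    the moments of orders [s - 1] and 1 of [L]. *)
Lemma wsum_mom_le (R : realType) n (A : probability (n.+1.-tuple R) R)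
    (L : probability R R) (s : R) : 1 < s ->
  (\int[A \x power L n.+1]_z (wsum z `^ s)%:E <= diag A s * mom s L +
    (s * n.+1%:R `^ (s - 1))%:E * (offdiag A s * (mom (s - 1) L * mom 1 L)))%E.
Proof.
move=> s1; rewrite -integral_diag// -integral_offdiag//.
have c0 (z : n.+1.-tuple R * n.+1.-tuple R) :
    0 <= \sum_(j < n.+1) \sum_(k < n.+1 | k != j)
     (`|tnth z.1 j| * `|tnth z.2 j|) `^ (s - 1) *
     (`|tnth z.1 k| * `|tnth z.2 k|).
  apply: sumr_ge0 => j _; apply: sumr_ge0 => k _.
  by rewrite mulr_ge0 ?powR_ge0 ?mulr_ge0.
have mprod (j : 'I_n.+1) : measurable_fun setT
    (fun z : n.+1.-tuple R * n.+1.-tuple R => `|tnth z.1 j| * `|tnth z.2 j|).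
  apply: measurable_funM.
    exact: (measurableT_comp (measurable_tnth_normr j) measurable_fst).
  exact: (measurableT_comp (measurable_tnth_normr j) measurable_snd).
have mc : measurable_fun setT (fun z : n.+1.-tuple R * n.+1.-tuple R =>
    \sum_(j < n.+1) \sum_(k < n.+1 | k != j)
     (`|tnth z.1 j| * `|tnth z.2 j|) `^ (s - 1) *
     (`|tnth z.1 k| * `|tnth z.2 k|)).
  apply: measurable_sum => j; apply: measurable_sum_cond => k.
  apply: measurable_funM => //.
  exact: (measurableT_comp (measurable_powR (s - 1)) (mprod j)).
have C0 : 0 <= s * n.+1%:R `^ (s - 1).
  by rewrite mulr_ge0 ?powR_ge0// ltW// (lt_trans _ s1).
rewrite -(ge0_integralZl _ measurableT); first last.
- by rewrite lee_fin.
- by move=> z _; rewrite lee_fin.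
- exact/measurable_EFinP.
rewrite -ge0_integralD//; first last.
- by apply/measurable_EFinP; exact: measurable_funM.
- by move=> z _; rewrite lee_fin mulr_ge0.
- by apply/measurable_EFinP; exact: measurable_sum_tnth_powR.
- by move=> z _; rewrite lee_fin sumr_ge0// => j _; exact: powR_ge0.
apply: ge0_le_integralE.
- by apply: (measurableT_comp (measurable_powR s)); exact: measurable_wsum.
- apply: measurable_funD; first exact: measurable_sum_tnth_powR.
  exact: measurable_funM.
- by move=> z; exact: powR_ge0.
- by move=> z; apply: powR_sum_le => // j; rewrite mulr_ge0.
Qed.

Lemma diag_ge0 (R : realType) n (A : probability (n.-tuple R) R) (s : R) :
  (0 <= diag A s)%E.
Proof.
apply: integral_ge0 => a _; rewrite lee_fin sumr_ge0// => j _.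
Qed.

Lemma offdiag_ge0 (R : realType) n (A : probability (n.-tuple R) R) (s : R) :
  (0 <= offdiag A s)%E.
Proof.
apply: integral_ge0 => a _; rewrite lee_fin sumr_ge0// => j _.
by rewrite sumr_ge0// => k _; rewrite mulr_ge0// powR_ge0.
Qed.

Lemma mom_ge0 (R : realType) (s : R) (L : probability R R) : (0 <= mom s L)%E.
Proof. by apply: integral_ge0 => t _; rewrite lee_fin powR_ge0. Qed.

(** * Uniform moment bounds along the iteration *)

Section iteration.
Context (R : realType) (N : nat) (c : nat -> R).
Hypothesis c_ge0 : forall i, 0 <= c i.
Hypothesis c_sum : \sum_(i < N) c i = 1.
Variable A : forall n : nat, probability (n.-tuple R) R.
Variable m : R.
Local Notation step := (step c_ge0 c_sum A m).

Definition lam (s : R) : \bar R := (\sum_(i < N) (c i)%:E * diag (A i.+1) s)%E.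

Definition off (s : R) : \bar R :=
  (\sum_(i < N) (c i)%:E *
     ((s * i.+1%:R `^ (s - 1))%:E * offdiag (A i.+1) s))%E.

Definition wsum_mom (s : R) L i : \bar R :=
  (\int[A i.+1 \x power L i.+1]_z (wsum z `^ s)%:E)%E.

Lemma lam_ge0 s : (0 <= lam s)%E.
Proof. by apply: sume_ge0 => i _; rewrite mule_ge0 ?diag_ge0// lee_fin. Qed.

Lemma off_ge0 s : 0 <= s -> (0 <= off s)%E.
Proof.
move=> s0; apply: sume_ge0 => i _.
by rewrite !mule_ge0 ?offdiag_ge0// lee_fin// mulr_ge0 ?powR_ge0.
Qed.

Lemma mom_step_eq s L : 0 < 1 + m * s ->
  (mom s (step L) = ((1 + m * s)^-1)%:E * \sum_(i < N) (c i)%:E * wsum_mom s L i)%E.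
Proof.
move=> D0; rewrite mom_step; congr (_ * _)%E.
  by rewrite -integral_unif_powR// addrAC subrr add0r.
apply: eq_bigr => i _; rewrite /wsum_mom fubini_tonelli1//; first last.
- by move=> z; rewrite lee_fin powR_ge0.
- apply/measurable_EFinP; apply: (measurableT_comp (measurable_powR s)).
  exact: measurable_wsum.
Qed.

Lemma sume_diag s L : (\sum_(i < N) (c i)%:E * (diag (A i.+1) s * mom s L) =
  lam s * mom s L)%E.
Proof.
rewrite ge0_sume_distrl; last first.
  by move=> i _; rewrite mule_ge0 ?diag_ge0// lee_fin.
by apply: eq_bigr => i _; rewrite muleA.
Qed.

(** At exponent 1 the power of the sum is additive, so the recurrence is exact; when [lam 1 = 1 + m]
    the mean is preserved. *)
Lemma mom1_step L : 0 < 1 + m -> (mom 1 (step L) = ((1 + m)^-1)%:E * (lam 1 * mom 1 L))%E.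
Proof.
move=> D0; rewrite mom_step_eq mulr1// -sume_diag; congr (_ * _)%E.
apply: eq_bigr => i _; congr (_ * _)%E; rewrite -integral_diag.
apply: eq_integral => z _; congr EFin; rewrite powRr1 ?wsum_ge0//.
by apply: eq_bigr => j _; rewrite powRr1// mulr_ge0.
Qed.

Lemma mom_step_le s L : 1 < s -> 0 < 1 + m * s ->
  (mom s (step L) <= ((1 + m * s)^-1)%:E *
     (lam s * mom s L + off s * (mom (s - 1) L * mom 1 L)))%E.
Proof.
move=> s1 D0; have s0 : 0 <= s by rewrite ltW// (lt_trans _ s1).
rewrite mom_step_eq//; apply: lee_wpmul2l; first by rewrite lee_fin invr_ge0 ltW.
rewrite -sume_diag /off ge0_sume_distrl; last first.
  move=> i _; rewrite !mule_ge0 ?offdiag_ge0// lee_fin// mulr_ge0 ?powR_ge0//.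
rewrite -big_split/=; apply: lee_sum => i _.
rewrite -!muleA -ge0_muleDr; last 2 first.
- by rewrite mule_ge0 ?diag_ge0 ?mom_ge0.
- rewrite !mule_ge0 ?offdiag_ge0 ?mom_ge0// lee_fin mulr_ge0 ?powR_ge0//.
by apply: lee_wpmul2l; [rewrite lee_fin|exact: wsum_mom_le].
Qed.

(** Pointwise, [|x|^s] is at most 1 or at most [|x|^t] according to whether [|x| <= 1]. *)
Lemma mom_le_add1 s t (L : probability R R) : 0 < s -> s <= t ->
  (mom s L <= 1 + mom t L)%E.
Proof.
move=> s0 st.
have -> : (1 + mom t L = \int[L]_x (1 + `|x| `^ t)%:E)%E.
  under eq_integral do rewrite EFinD.
  rewrite ge0_integralD//; first by rewrite prob_integral_cst.
  by apply/measurable_EFinP; exact: measurable_powRn.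
apply: ge0_le_integralE.
- exact: measurable_powRn.
- by apply: measurable_funD => //; exact: measurable_powRn.
- by move=> x; exact: powR_ge0.
move=> x; have [x1|x1] := leP `|x| 1.
  rewrite (@le_trans _ _ 1)// ?lerDl ?powR_ge0//.
  by rewrite -[leRHS](congr1 (fun f => f s) (powR1 R)) ge0_ler_powR ?nnegrE// ltW.
by rewrite (@le_trans _ _ (`|x| `^ t))// ?lerDr// ler_powR// ltW.
Qed.

Definition iter_step k : probability R R := iter k step (dirac (1 : R)).

Lemma mom_dirac s : mom s (dirac (1 : R)) = 1%E.
Proof.
rewrite /mom integral_dirac//; first by rewrite diracT mul1e normr1 powR1.
by apply/measurable_EFinP; exact: measurable_powRn.
Qed.

Hypothesis lam1 : lam 1 = (1 + m)%:E.
Hypothesis m1 : 0 < 1 + m.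
Hypothesis off_lty : forall s, 1 < s -> (off s < +oo)%E.

Lemma mom1_iter_step k : mom 1 (iter_step k) = 1%E.
Proof.
elim: k => [|k IH]; first exact: mom_dirac.
rewrite /iter_step iterS mom1_step// -/(iter_step k) IH mule1 lam1 -EFinM mulVf//.
by rewrite gt_eqF.
Qed.

(* The s-th moment of the iterates obeys b_(k+1) <= rho b_k + C with
   rho = lam s / (1 + m s) < 1, where C is controlled by the moment of
   order s - 1, hence the induction. *)
Lemma mom_iter_step_bounded (n : nat) s : 0 < s -> s <= n.+1%:R ->
  (forall t, 1 < t -> t <= s -> (lam t < (1 + m * t)%:E)%E) ->
  exists2 B : R, 0 <= B & forall k, (mom s (iter_step k) <= B%:E)%E.
Proof.
have base t : 0 < t -> t <= 1 ->
    exists2 B : R, 0 <= B & forall k, (mom t (iter_step k) <= B%:E)%E.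
  move=> t0 t1; exists 2 => // k.
  by rewrite (le_trans (mom_le_add1 _ t0 t1))// mom1_iter_step -EFinD.
elim: n s => [|n IH] s s0 sn hs; first exact: base.
have [s1|s1] := leP s 1; first exact: base.
have [| | |B' B'0 hB'] := IH (s - 1).
- by rewrite subr_gt0.
- by rewrite lerBlDr natr1.
- by move=> t t1 ts; apply: hs => //; rewrite (le_trans ts)// gerBl.
have lD := hs s s1 (lexx s).
have D0 : 0 < 1 + m * s by rewrite -lte_fin (le_lt_trans (lam_ge0 s)).
have lfin : lam s \is a fin_num.
  by rewrite ge0_fin_numE ?lam_ge0// (lt_trans lD)// ltry.
have ofin : off s \is a fin_num.
  by rewrite ge0_fin_numE ?off_lty// off_ge0// ltW.
pose l := fine (lam s); pose o := fine (off s); pose D := 1 + m * s.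
have l0 : 0 <= l by rewrite fine_ge0 ?lam_ge0.
have o0 : 0 <= o by rewrite fine_ge0 ?off_ge0// ltW.
have lD' : l < D by rewrite -lte_fin fineK.
(* The maximum of the initial moment 1 and of the fixed point of [b -> (l b + o B') / D]. *)
pose B := Num.max 1 (o * B' / (D - l)).
have B1 : 1 <= B by rewrite le_max lexx.
have hB : o * B' <= (D - l) * B.
  by rewrite [leRHS]mulrC -ler_pdivrMr ?subr_gt0// le_max lexx orbT.
exists B; first exact: le_trans B1.
elim=> [|k IHk]; first by rewrite mom_dirac lee_fin.
rewrite /iter_step iterS -/(iter_step k); apply: (le_trans (mom_step_le _ s1 D0)).
rewrite mom1_iter_step mule1 -[lam s]fineK// -[off s]fineK//.
apply: (@le_trans _ _ ((D^-1)%:E * (l%:E * B%:E + o%:E * B'%:E))%E).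
  apply: lee_wpmul2l; first by rewrite lee_fin invr_ge0 ltW.
  by apply: leeD; apply: lee_wpmul2l; rewrite ?lee_fin.
rewrite -[(l%:E * _)%E]EFinM -[(o%:E * _)%E]EFinM -EFinD -EFinM lee_fin.
rewrite mulrC ler_pdivrMr//.
by move: hB; rewrite /D; lra.
Qed.

End iteration.

(** * The critical exponent *)

(** Equality of the sums forces equality term by term; finiteness allows the other terms to be
    cancelled. *)
Lemma sume_le_eq (R : realType) (n : nat) (a b : 'I_n -> \bar R) :
  (forall i, 0 <= a i)%E -> (forall i, a i <= b i)%E ->
  (\sum_i b i <= \sum_i a i)%E -> (\sum_i a i < +oo)%E ->
  forall i, (b i <= a i)%E.
Proof.
move=> a0 ab; move=> + + i; rewrite (bigD1 i)//= [leRHS](bigD1 i)//=.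
rewrite [X in (X < _)%E](bigD1 i)//=.
set Sb := (\sum_(j | j != i) b j)%E; set Sa := (\sum_(j | j != i) a j)%E.
have SS : (Sa <= Sb)%E by apply: lee_sum.
have Sa0 : (0 <= Sa)%E by apply: sume_ge0.
move=> h aoo.
have Safin : Sa \is a fin_num.
  by rewrite ge0_fin_numE// (le_lt_trans _ aoo)// leeDr.
rewrite -(leeD2rE _ _ Safin); apply: le_trans h.
exact: leeD2l.
Qed.

(** The hypotheses make [f - g] a nonnegative function of integral 0, so [f = g] almost everywhere,
    and [h] vanishes wherever [f = g]. *)
Lemma integral_eq0_gap d (T : measurableType d) (R : realType)
    (mu : {measure set T -> \bar R}) (f g h : T -> R) :
  measurable_fun setT f -> measurable_fun setT g -> measurable_fun setT h ->
  (forall x, 0 <= g x) -> (forall x, g x <= f x) -> (forall x, 0 <= h x) ->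
  (forall x, 0 < h x -> g x < f x) ->
  (\int[mu]_x (f x)%:E <= \int[mu]_x (g x)%:E)%E ->
  (\int[mu]_x (g x)%:E < +oo)%E ->
  (\int[mu]_x (h x)%:E = 0)%E.
Proof.
move=> mf mg mh g0 gf h0 hgf fg goo.
have mfg : measurable_fun setT (fun x => f x - g x) by exact: measurable_funB.
have fg0 x : 0 <= f x - g x by rewrite subr_ge0.
have eD : (\int[mu]_x (f x)%:E =
    \int[mu]_x (f x - g x)%:E + \int[mu]_x (g x)%:E)%E.
  rewrite -(ge0_integralD _ measurableT); first last.
  - exact/measurable_EFinP.
  - by move=> x _; rewrite lee_fin.
  - exact/measurable_EFinP.
  - by move=> x _; rewrite lee_fin.
  by apply: eq_integral => x _; rewrite -EFinD subrK.
have gfin : (\int[mu]_x (g x)%:E)%E \is a fin_num.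
  by rewrite ge0_fin_numE// integral_ge0// => x _; rewrite lee_fin.
have i0 : (\int[mu]_x (f x - g x)%:E = 0)%E.
  apply/eqP; rewrite eq_le; apply/andP; split; last first.
    by apply: integral_ge0 => x _; rewrite lee_fin.
  by rewrite -(leeD2rE _ _ gfin) add0e -eD.
have : (\int[mu]_x `|(f x - g x)%:E| = 0)%E.
  rewrite -[RHS]i0; apply: eq_integral => x _.
  by rewrite gee0_abs// lee_fin.
have mfgE : measurable_fun setT (fun x => (f x - g x)%:E) by exact/measurable_EFinP.
move/(ae_eq_integral_abs mu measurableT mfgE).1 => aefg.
rewrite -(integral0 mu setT); apply: ae_eq_integral => //.
- exact/measurable_EFinP.
apply: filterS aefg => x /= /(_ I) [] fgx _; congr EFin; apply/eqP.
rewrite eq_le h0 andbT leNgt; apply/negP => /hgf.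
by rewrite -subr_gt0 fgx ltxx.
Qed.

Section nonzero_indicator.
Context (R : realType).

Definition nz (t : R) : R := \1_(~` [set 0]) t.

Lemma nz0 : nz 0 = 0.
Proof. by rewrite /nz indicE memNset//= => /(_ erefl). Qed.

Lemma nz1 t : t != 0 -> nz t = 1.
Proof. by move=> /eqP t0; rewrite /nz indicE mem_set. Qed.

Lemma nz_ge0 t : 0 <= nz t. Proof. by rewrite /nz indicE. Qed.

Lemma measurable_nz : measurable_fun setT nz.
Proof. by apply: measurable_indic; apply: measurableC. Qed.

(** Otherwise [t = 0] almost surely and the first moment would be 0. *)
Lemma integral_nz_gt0 (L : probability R R) :
  (0 < mom 1 L)%E -> (0 < \int[L]_t (nz t)%:E)%E.
Proof.
move=> m0; rewrite lt0e; apply/andP; split; last first.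
  by apply: integral_ge0 => t _; rewrite lee_fin nz_ge0.
apply/negP => /eqP i0; move: m0; rewrite /mom.
rewrite (@integral_eq0_gap _ _ R L nz (cst 0)) ?ltxx//.
- exact: measurable_nz.
- exact: measurable_powRn.
- move=> t; have [->|t0 _] := eqVneq t 0; first by rewrite normr0 powRr1// ltxx.
  by rewrite nz1.
- by rewrite i0 prob_integral_cst.
- by rewrite prob_integral_cst ltry.
Qed.

End nonzero_indicator.

Section nonzero_pairs.
Context (R : realType) (n : nat) (A : probability (n.-tuple R) R)
  (L : probability R R) (s : R).
Hypothesis s1 : 1 < s.
Hypothesis L0 : (0 < mom 1 L)%E.
Hypothesis h1 : (\int[A \x power L n]_z (wsum z `^ s)%:E <= diag A s * mom s L)%E.
Hypothesis h2 : (diag A s * mom s L < +oo)%E.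

Lemma measurable_nz_tnth (j : 'I_n) :
  measurable_fun setT (fun a : n.-tuple R => nz (tnth a j)).
Proof. by apply: (measurableT_comp (@measurable_nz R)); exact: measurable_tnth. Qed.

Let mnz2 (j k : 'I_n) :
  measurable_fun setT (fun a : n.-tuple R => nz (tnth a j) * nz (tnth a k)).
Proof. by apply: measurable_funM; exact: measurable_nz_tnth. Qed.

(** Superadditivity is strict where two products [a_i tau_i] are nonzero, so [h1] makes this event
    null. Its probability splits into a factor for [a] and one for [tau], and the latter is positive
    by [L0]. *)
Lemma integral_nz_pair (j k : 'I_n) : k != j ->
  (\int[A]_a (nz (tnth a j) * nz (tnth a k))%:E = 0)%E.
Proof.
move=> kj.
have nn0 (a : n.-tuple R) : 0 <= nz (tnth a j) * nz (tnth a k).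
  by rewrite mulr_ge0 ?nz_ge0.
have : (\int[A \x power L n]_z
   ((nz (tnth z.1 j) * nz (tnth z.1 k)) *
    (nz (tnth z.2 j) * nz (tnth z.2 k)))%:E = 0)%E.
  apply: (@integral_eq0_gap _ _ _ _ (fun z => wsum z `^ s)
    (fun z => \sum_(j < n) (`|tnth z.1 j| * `|tnth z.2 j|) `^ s)).
  - by apply: (measurableT_comp (measurable_powR s)); exact: measurable_wsum.
  - exact: measurable_sum_tnth_powR.
  - apply: measurable_funM.
      exact: (measurableT_comp (mnz2 j k) measurable_fst).
    exact: (measurableT_comp (mnz2 j k) measurable_snd).
  - by move=> z; apply: sumr_ge0 => i _; exact: powR_ge0.
  - by move=> z; apply: sum_powR_le => // i; rewrite mulr_ge0.
  - by move=> z; rewrite mulr_ge0.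
  - move=> [a v]/= h.
    have aj : tnth a j != 0.
      by apply: contraTneq h => ->; rewrite nz0 !mul0r ltxx.
    have ak : tnth a k != 0.
      by apply: contraTneq h => ->; rewrite nz0 mulr0 !mul0r ltxx.
    have vj : tnth v j != 0.
      by apply: contraTneq h => ->; rewrite nz0 mul0r mulr0 ltxx.
    have vk : tnth v k != 0.
      by apply: contraTneq h => ->; rewrite nz0 !mulr0 ltxx.
    apply: (sum_powR_lt s1 _ kj) => [i|//|//]; first by rewrite mulr_ge0.
    + by rewrite mulr_gt0 ?normr_gt0.
    + by rewrite mulr_gt0 ?normr_gt0.
  - by rewrite integral_diag.
  - by rewrite integral_diag.
rewrite (integral_prodM A (power L n)
  (f := fun a : n.-tuple R => nz (tnth a j) * nz (tnth a k))
  (g := fun a : n.-tuple R => nz (tnth a j) * nz (tnth a k)))//.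
rewrite (integral_power_coord2 L (f := @nz R) (g := @nz R) kj)//; first last.
- exact: measurable_nz.
- exact: measurable_nz.
move/eqP; rewrite mule_eq0 => /orP[/eqP//|/eqP p0].
have p := integral_nz_gt0 L0.
by have := mule_gt0 p p; rewrite p0 ltxx.
Qed.

(** Pointwise the count is at most 1 plus the number of ordered pairs of distinct nonzero
    coordinates: one nonzero coordinate pairs with each of the others. The pairs have integral 0. *)
Lemma integral_count_nz :
  (\int[A]_a (\sum_(j < n) nz (tnth a j))%:E <= 1)%E.
Proof.
have mpair (j : 'I_n) : measurable_fun setT (fun a : n.-tuple R =>
    \sum_(k < n | k != j) nz (tnth a j) * nz (tnth a k)).
  exact: measurable_sum_cond.
have pair0 (j : 'I_n) (a : n.-tuple R) :
    0 <= \sum_(k < n | k != j) nz (tnth a j) * nz (tnth a k).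
  by apply: sumr_ge0 => k _; rewrite mulr_ge0 ?nz_ge0.
apply: (@le_trans _ _ (\int[A]_a (1 + \sum_(j < n) \sum_(k < n | k != j)
    nz (tnth a j) * nz (tnth a k))%:E)%E).
  apply: ge0_le_integralE.
  - by apply: measurable_sum => j; exact: measurable_nz_tnth.
  - by apply: measurable_funD => //; exact: measurable_sum.
  - by move=> a; apply: sumr_ge0 => j _; exact: nz_ge0.
  move=> a.
  have [[j j0]|all0] := pselect (exists j, tnth a j != 0); last first.
    rewrite big1 ?addr_ge0 ?sumr_ge0// => j _.
    have [->|jn0] := eqVneq (tnth a j) 0; first exact: nz0.
    by exfalso; apply: all0; exists j.
  rewrite (bigD1 j)//= nz1// lerD2l [leRHS](bigD1 j)//=.
  rewrite (@le_trans _ _ (\sum_(k < n | k != j) nz (tnth a j) * nz (tnth a k)))//.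
    by under [leRHS]eq_bigr do rewrite nz1// mul1r.
  by rewrite lerDl sumr_ge0.
under eq_integral do rewrite EFinD.
rewrite ge0_integralD//; first last.
- by apply/measurable_EFinP; exact: measurable_sum.
- by move=> a _; rewrite lee_fin sumr_ge0.
rewrite prob_integral_cst integral_sumE// big1 ?adde0// => j _.
rewrite integral_sumE//; last by move=> k a; rewrite mulr_ge0 ?nz_ge0.
by rewrite big1// => k kj; exact: integral_nz_pair.
Qed.

End nonzero_pairs.

(** Young's inequality [q t <= t^q + (q - 1)] is applied to nonzero coordinates only, so [q - 1] is
    paid at most once on average. *)
Lemma diag_young (R : realType) n (A : probability (n.-tuple R) R) (q : R) :
  1 < q -> (\int[A]_a (\sum_(j < n) nz (tnth a j))%:E <= 1)%E ->
  (q%:E * diag A 1 <= diag A q + (q - 1)%:E)%E.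
Proof.
move=> q1 cnt; have q0 : 0 < q by exact: lt_trans q1.
have md r : measurable_fun setT
    (fun a : n.-tuple R => \sum_(j < n) `|tnth a j| `^ r).
  by apply: measurable_sum => j; exact: measurable_tnth_powR.
have mn : measurable_fun setT (fun a : n.-tuple R => \sum_(j < n) nz (tnth a j)).
  by apply: measurable_sum => j; exact: measurable_nz_tnth.
have n0 (a : n.-tuple R) : 0 <= \sum_(j < n) nz (tnth a j).
  by apply: sumr_ge0 => j _; exact: nz_ge0.
have d0 r (a : n.-tuple R) : 0 <= \sum_(j < n) `|tnth a j| `^ r.
  by apply: sumr_ge0 => j _; exact: powR_ge0.
have q10 : 0 <= q - 1 by rewrite subr_ge0 ltW.
apply: (@le_trans _ _ (diag A q + (q - 1)%:E *
    \int[A]_a (\sum_(j < n) nz (tnth a j))%:E)%E); last first.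
  apply: leeD2l; rewrite -[leRHS]mule1; apply: lee_wpmul2l => //.
rewrite /diag -!(ge0_integralZl _ measurableT); try exact/measurable_EFinP; first last.
- by rewrite lee_fin ltW.
- by move=> a _; rewrite lee_fin.
- by rewrite lee_fin.
- by move=> a _; rewrite lee_fin.
rewrite -(ge0_integralD _ measurableT); first last.
- by apply/measurable_EFinP; exact: measurable_funM.
- by move=> a _; rewrite lee_fin mulr_ge0.
- exact/measurable_EFinP.
- by move=> a _; rewrite lee_fin.
apply: ge0_le_integralE.
- exact: measurable_funM.
- by apply: measurable_funD => //; exact: measurable_funM.
- by move=> a; rewrite mulr_ge0// ltW.
move=> a; rewrite !mulr_sumr -big_split/=; apply: ler_sum => j _.
rewrite powRr1//; have [->|t0] := eqVneq (tnth a j) 0.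
  by rewrite normr0 nz0 !mulr0 addr0 powR_ge0.
rewrite nz1// mulr1.
have := powR_young (normr_ge0 (tnth a j)) q1.
move/(ler_wpM2l (ltW q0)) => /le_trans; apply.
by rewrite mulrDr mulrBr mulr1 mulfV ?gt_eqF// mulrCA mulfV ?gt_eqF// mulr1.
Qed.

Section critical_exponent.
Context (R : realType) (N : nat) (c : nat -> R).
Hypothesis c_ge0 : forall i, 0 <= c i.
Hypothesis c_sum : \sum_(i < N) c i = 1.
Variable A : forall n : nat, probability (n.-tuple R) R.
Variable m : R.
Local Notation step := (step c_ge0 c_sum A m).
Local Notation lam := (lam N c A).

(* At a critical exponent the weighted sums lose nothing to superadditivity
   of x^s, so almost surely at most one coordinate is nonzero; Young's
   inequality then makes 1 a minimum point of mu on [1, +oo[. *)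
Lemma no_critical_moment (s q : R) L : 1 < s -> 0 < 1 + m * s ->
  lam s = (1 + m * s)%:E -> (0 < mom 1 L)%E -> (mom s L < +oo)%E ->
  (mom s (step L) <= mom s L)%E -> 1 < q ->
  (q%:E * lam 1 <= lam q + (q - 1)%:E)%E.
Proof.
move=> s1 D0 lamD L0 Loo TL q1; have q0 : 0 < q by exact: lt_trans q1.
(* The inequality [TL] multiplied by [1 + m s], which is [lam s] at the critical exponent. *)
have sum_le : (\sum_(i < N) (c i)%:E * wsum_mom A s L i <=
    \sum_(i < N) (c i)%:E * (diag (A i.+1) s * mom s L))%E.
  rewrite (@sume_diag _ N c c_ge0 A s L) lamD;
  move: TL; rewrite mom_step_eq// => /(lee_wpmul2l _).
  move=> /(_ (1 + m * s)%:E); rewrite lee_fin (ltW D0) => /(_ isT).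
  by rewrite muleA -EFinM mulfV ?gt_eqF// mul1e.
have sum_lty : (\sum_(i < N) (c i)%:E * (diag (A i.+1) s * mom s L) < +oo)%E.
  by rewrite (@sume_diag _ N c c_ge0 A s L) lamD lte_mul_pinfty// lee_fin ltW.
have term_ge0 (i : 'I_N) : (0 <= (c i)%:E * (diag (A i.+1) s * mom s L))%E.
  by rewrite !mule_ge0 ?diag_ge0 ?mom_ge0// lee_fin.
have each (i : 'I_N) : ((c i)%:E * wsum_mom A s L i <=
    (c i)%:E * (diag (A i.+1) s * mom s L))%E.
  apply: (@sume_le_eq R N (fun i => (c i)%:E * (diag (A i.+1) s * mom s L))%E
    (fun i => (c i)%:E * wsum_mom A s L i)%E) => // j.
  by apply: lee_wpmul2l; [rewrite lee_fin|exact: diag_le].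
have key (i : 'I_N) : ((c i)%:E * (q%:E * diag (A i.+1) 1) <=
    (c i)%:E * (diag (A i.+1) q + (q - 1)%:E))%E.
  (* A term of weight 0 gives no information on [A (i + 1)], but then both sides vanish. *)
  have := c_ge0 i; rewrite le_eqVlt => /orP[/eqP <-|ci0]; first by rewrite !mul0e.
  apply: lee_wpmul2l; first by rewrite lee_fin.
  apply: diag_young => //; apply: integral_count_nz s1 L0 _ _.
    by have := each i; rewrite lee_pmul2l// lte_fin.
  have h : ((c i)%:E * (diag (A i.+1) s * mom s L) < +oo)%E.
    by apply: le_lt_trans sum_lty; rewrite [leRHS](bigD1 i)//= leeDl// sume_ge0.
  rewrite ltNge leye_eq; apply/negP => /eqP e.
  by move: h; rewrite e gt0_muley ?lte_fin.
have -> : (q%:E * lam 1 =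
    \sum_(i < N) (c i)%:E * (q%:E * diag (A i.+1) 1))%E.
  rewrite ge0_sume_distrr; last first.
    by move=> i _; rewrite mule_ge0 ?diag_ge0// lee_fin.
  by apply: eq_bigr => i _; rewrite muleCA.
apply: (le_trans (lee_sum _ (fun i _ => key i))).
rewrite le_eqVlt; apply/orP; left; apply/eqP.
have e : (q - 1)%:E = (\sum_(i < N) (c i)%:E * (q - 1)%:E)%E.
  by rewrite -ge0_sume_distrl ?sumEFin ?c_sum ?mul1e// => i _; rewrite lee_fin.
rewrite [in RHS]e -big_split/=; apply: eq_bigr => i _.
rewrite ge0_muleDr ?diag_ge0//. by rewrite lee_fin subr_ge0 ltW.
Qed.

End critical_exponent.

(** * Regularity of the spectral function *)

(** Young's inequality for [x^(th p1)] and [x^((1 - th) p2)] with exponents [1 / th] and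
    [1 / (1 - th)]. *)
Lemma powR_convex (R : realType) (x p1 p2 th : R) : 0 <= x -> 0 < p1 -> 0 < p2 ->
  0 < th -> th < 1 ->
  x `^ (th * p1 + (1 - th) * p2) <= th * x `^ p1 + (1 - th) * x `^ p2.
Proof.
move=> x0 p10 p20 th0 th1; have th1' : 0 < 1 - th by rewrite subr_gt0.
have [->|xn0] := eqVneq x 0.
  by rewrite !powR0 ?gt_eqF ?addr_gt0 ?mulr_gt0// !mulr0 addr0.
have xp : 0 < x by rewrite lt_neqAle eq_sym xn0.
have := @conjugate_powR R (x `^ (th * p1)) (x `^ ((1 - th) * p2)) th^-1 (1 - th)^-1.
rewrite !powR_ge0 !invr_gt0 th0 th1' !invrK addrC subrK.
move=> /(_ isT isT isT isT erefl).
rewrite -powRD_gt0// -!powRrM => /le_trans; apply.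
rewrite [th * p1]mulrC [(1 - th) * p2]mulrC !mulfK ?gt_eqF//.
by rewrite mulrC [X in _ + X]mulrC.
Qed.

(** The form in which compact support enters the moment estimates. *)
Definition essentially_bounded (R : realType) n (A : probability (n.-tuple R) R) :=
  exists2 M : R, 0 <= M & A [set a | forall j, `|tnth a j| <= M] = 1%E.

Lemma measurable_cube (R : realType) n (M : R) :
  measurable [set a : n.-tuple R | forall j, `|tnth a j| <= M].
Proof.
have -> : [set a : n.-tuple R | forall j, `|tnth a j| <= M] =
    \bigcap_(j in [set: 'I_n]) ((fun a : n.-tuple R => `|tnth a j|) @^-1` `]-oo, M]).
  apply/seteqP; split => a /= h j.
    by move=> _; rewrite /= in_itv/=; exact: h.
  by have := h j I; rewrite /= in_itv.
apply: fin_bigcap_measurable; first exact: finite_finset.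
by move=> j _; rewrite -[X in measurable X]setTI; apply: measurable_tnth_normr.
Qed.

Section bounded_moments.
Context (R : realType) (n : nat) (A : probability (n.-tuple R) R).
Hypothesis bA : essentially_bounded A.

(** [C] is a function of [M] because the essential bound is only known to exist. *)
Lemma integral_bounded_lty (f : n.-tuple R -> R) (C : R -> R) :
  measurable_fun setT f -> (forall a, 0 <= f a) ->
  (forall M a, 0 <= M -> (forall j, `|tnth a j| <= M) -> f a <= C M) ->
  (\int[A]_a (f a)%:E < +oo)%E.
Proof.
move=> mf f0 fC; have [M M0 AM] := bA.
rewrite -(integral_full (measurable_cube (n:=n) M) AM)//; first last.
- exact/measurable_EFinP.
apply: (@le_lt_trans _ _
    (\int[A]_(a in [set a : n.-tuple R | forall j, (`|tnth a j| <= M)%R]) (C M)%:E)%E).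
  apply: ge0_le_integral => //.
  - exact: measurable_cube.
  - by move=> a _; rewrite lee_fin.
  - by apply/measurable_EFinP/measurable_funTS.
  - by move=> a aM; rewrite lee_fin fC.
rewrite integral_cst//=; last exact: measurable_cube.
by rewrite [X in (_ * X)%E]AM mule1 ltry.
Qed.

Lemma diag_lty s : 0 < s -> (diag A s < +oo)%E.
Proof.
move=> s0; apply: (integral_bounded_lty (C := fun M => \sum_(j < n) M `^ s)).
- by apply: measurable_sum => j; exact: measurable_tnth_powR.
- by move=> a; apply: sumr_ge0 => j _; exact: powR_ge0.
move=> M a M0 aM; apply: ler_sum => j _.
by rewrite ge0_ler_powR ?nnegrE// ltW.
Qed.

Lemma offdiag_lty s : 1 < s -> (offdiag A s < +oo)%E.
Proof.
move=> s1; apply: (integral_bounded_lty (C := fun M =>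
  \sum_(j < n) \sum_(k < n | k != j) M `^ (s - 1) * M)).
- apply: measurable_sum => j; apply: measurable_sum_cond => k.
  by apply: measurable_funM; [exact: measurable_tnth_powR|exact: measurable_tnth_normr].
- move=> a; apply: sumr_ge0 => j _; apply: sumr_ge0 => k _.
  by rewrite mulr_ge0 ?powR_ge0.
move=> M a M0 aM; apply: ler_sum => j _; apply: ler_sum => k _.
by rewrite ler_pM ?powR_ge0// ge0_ler_powR ?nnegrE// subr_ge0 ltW.
Qed.

Lemma diag_convex p1 p2 th : 0 < p1 -> 0 < p2 -> 0 < th -> th < 1 ->
  (diag A (th * p1 + (1 - th) * p2) <=
   th%:E * diag A p1 + (1 - th)%:E * diag A p2)%E.
Proof.
move=> p10 p20 th0 th1; have th1' : 0 < 1 - th by rewrite subr_gt0.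
have md r : measurable_fun setT
    (fun a : n.-tuple R => \sum_(j < n) `|tnth a j| `^ r).
  by apply: measurable_sum => j; exact: measurable_tnth_powR.
have d0 r (a : n.-tuple R) : 0 <= \sum_(j < n) `|tnth a j| `^ r.
  by apply: sumr_ge0 => j _; exact: powR_ge0.
rewrite /diag -!(ge0_integralZl _ measurableT); try exact/measurable_EFinP; first last.
- by rewrite lee_fin ltW.
- by move=> a _; rewrite lee_fin.
- by rewrite lee_fin ltW.
- by move=> a _; rewrite lee_fin.
rewrite -(ge0_integralD _ measurableT); first last.
- by apply/measurable_EFinP; exact: measurable_funM.
- by move=> a _; rewrite lee_fin mulr_ge0// ltW.
- by apply/measurable_EFinP; exact: measurable_funM.
- by move=> a _; rewrite lee_fin mulr_ge0// ltW.
apply: ge0_le_integralE => //.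
- by apply: measurable_funD => //; exact: measurable_funM.
move=> a; rewrite !mulr_sumr -big_split/=; apply: ler_sum => j _.
exact: powR_convex.
Qed.

(** For [b = 0] the function is constantly 0 near [x > 0]; otherwise it is [e^(s ln b)]. *)
Lemma continuous_powRr (b x : R) : 0 <= b -> 0 < x ->
  {for x, continuous (fun s => b `^ s)}.
Proof.
move=> b0 x0; have [->|bn0] := eqVneq b 0.
  rewrite /prop_for /continuous_at powR0 ?gt_eqF//; apply: cvg_near_cst.
  near=> s; rewrite powR0// gt_eqF//.
  by near: s; exact: lt_nbhsr.
rewrite (_ : (fun s => b `^ s) = (fun s => expR (s * ln b))); last first.
  by apply/funext => s; rewrite /powR (negbTE bn0).
apply: (@cvg_comp _ _ _ (fun s => s * ln b) expR _ (nbhs (x * ln b))).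
  exact: mulrr_continuous.
exact: continuous_expR.
Unshelve. all: by end_near. Qed.

Lemma continuous_diag p : 0 < p -> {for p, continuous (fun s => fine (diag A s))}.
Proof.
move=> p0.
pose f s (a : n.-tuple R) := \sum_(j < n) `|tnth a j| `^ s.
have mf s : measurable_fun setT (f s).
  by apply: measurable_sum => j; exact: measurable_tnth_powR.
have f0 s a : 0 <= f s a by apply: sumr_ge0 => j _; exact: powR_ge0.
have fint s : 0 < s -> A.-integrable setT (EFin \o f s).
  move=> s0; apply/integrableP; split; first exact/measurable_EFinP.
  rewrite (_ : (\int[A]_a _)%E = diag A s); first exact: diag_lty.
  by apply: eq_integral => a _; rewrite /= ger0_norm.
(* Dominated continuity on []p/2, p + 1[]: there every exponent is positive and
   [t^s <= 1 + t^(p+1)]. *)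
apply: (@continuity_under_integral R _ _ A f setT measurableT (p / 2) (p + 1) _ _
  (fun a => \sum_(j < n) (1 + `|tnth a j| `^ (p + 1))))%R.
- move=> s /=; rewrite in_itv/= => /andP[ps _]; apply: fint.
  by apply: lt_trans ps; rewrite divr_gt0.
- apply: aeW => a _ s; rewrite inE/= in_itv/= => /andP[ps _].
  apply: cvg_big => //; first exact: add_continuous.
  move=> j _; apply: continuous_powRr => //; apply: lt_trans ps.
  by rewrite divr_gt0.
- have fint1 := fint (p + 1) (addr_gt0 p0 ltr01).
  have cint : A.-integrable setT (EFin \o cst n%:R).
    exact: finite_measure_integrable_cst.
  have := integrableD measurableT cint fint1.
  congr (A.-integrable _ _); apply/funext => a /=; rewrite -EFinD; congr EFin.
  by rewrite /f big_split/= sumr_const card_ord.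
- move=> s /=; rewrite in_itv/= => /andP[ps sp]; apply: aeW => a _.
  rewrite ger0_norm//; apply: ler_sum => j _.
  have s0 : 0 < s by apply: lt_trans ps; rewrite divr_gt0.
  have [a1|a1] := leP `|tnth a j| 1.
    rewrite (@le_trans _ _ 1)// ?lerDl ?powR_ge0//.
    by rewrite -[leRHS](congr1 (fun f => f s) (powR1 R)) ge0_ler_powR ?nnegrE// ltW.
  rewrite (@le_trans _ _ (`|tnth a j| `^ (p + 1)))// ?lerDr//.
  by rewrite ler_powR// ltW.
- by rewrite inE/= in_itv/= ltrDl ltr01 andbT ltr_pdivrMr// ltr_pMr// ltr1n.
Qed.

End bounded_moments.

(** * From compact support to essential boundedness *)

Section compact_support.
Context (R : realType) (n : nat).
Local Notation to_row a := (\row_i tnth a i : 'rV[R]_n).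

Lemma measurable_rational_box (q : {ffun 'I_n -> rat}) (e : R) :
  measurable [set a : n.-tuple R | forall j, `|tnth a j - ratr (q j)| < e].
Proof.
have -> : [set a : n.-tuple R | forall j, `|tnth a j - ratr (q j)| < e] =
    \bigcap_(j in [set: 'I_n]) ((fun a : n.-tuple R => `|tnth a j - ratr (q j)|)
      @^-1` `]-oo, e[).
  apply/seteqP; split => a /= h j.
    by move=> _; rewrite /= in_itv/=; exact: h.
  by have := h j I; rewrite /= in_itv.
apply: fin_bigcap_measurable; first exact: finite_finset.
move=> j _; rewrite -[X in measurable X]setTI.
have : measurable_fun setT (fun a : n.-tuple R => `|tnth a j - ratr (q j)|).
  apply: measurableT_comp => //; apply: measurable_funB => //.
  exact: measurable_tnth.
by apply => //; exact: measurable_itv.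
Qed.

(** Open sets belong to the product sigma-algebra: each is the countable union of the rational boxes
    that it contains. *)
Lemma measurable_open_row (O : set 'rV[R]_n) : open O ->
  measurable [set a : n.-tuple R | O (to_row a)].
Proof.
move=> oO.
pose box (u : {ffun 'I_n -> rat} * nat) :=
  [set a : n.-tuple R | forall j, `|tnth a j - ratr (u.1 j)| < harmonic u.2].
pose F u := [set a : n.-tuple R | box u a /\ box u `<=` [set a | O (to_row a)]].
have -> : [set a : n.-tuple R | O (to_row a)] = \bigcup_u F u.
  apply/seteqP; split => [a /= Oa|a [u _ [ua uO]]]; last exact: uO.
  have /nbhs_ballP[e /= e0 aeO] : nbhs (to_row a) O by apply: open_nbhs_nbhs.
  (* Half of [e], since both [a] and any point of the box lie within this radius of the rational
     centre. *)
  have [k _ hk] : \forall k \near \oo, harmonic k < e / 2 :> R.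
    by apply: (cvgr_lt 0); [exact: cvg_harmonic|rewrite divr_gt0].
  have {}hk := hk k (leqnn k).
  have /choice[q hq] : forall j, exists q : rat, `|tnth a j - ratr q| < harmonic k.
    move=> j;
    have [|q] := @rat_in_itvoo R (tnth a j - harmonic k) (tnth a j + harmonic k).
      by rewrite ltrD2l -subr_gt0 opprK addr_gt0 ?harmonic_gt0.
    by rewrite in_itv => hq; exists q; rewrite ltr_distlC.
  exists ([ffun j => q j], k) => //; split; first by move=> j /=; rewrite ffunE.
  move=> v vb /=; apply: aeO; split=> // i j; rewrite !mxE.
  have := vb j; rewrite ffunE => hv.
  apply: (le_lt_trans (ler_distD (ratr (q j)) _ _)).
  rewrite [e]splitr ltrD//; first by rewrite (lt_trans (hq j)).
  by rewrite distrC (lt_trans hv).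
apply: countable_bigcupT_measurable => // u.
have [uO|uO] := pselect (box u `<=` [set a | O (to_row a)]).
  rewrite (_ : F u = box u); first exact: measurable_rational_box.
  by apply/seteqP; split => a //= [].
rewrite (_ : F u = set0); first exact: measurable0.
by apply/seteqP; split => a //= [].
Qed.

(** Compactness bounds the norm on [C]; closedness of [C] makes its complement measurable, so the
    null set passes to the complement of a cube by monotonicity. *)
Lemma compactly_supported_bounded (A : probability (n.-tuple R) R) :
  compactly_supported A -> essentially_bounded A.
Proof.
move=> [C [cC AC]].
have oC : open (~` C).
  by apply: closed_openC; apply: compact_closed cC; exact: norm_hausdorff.
have mC := measurable_open_row oC.
have [M [_ hM]] := compact_bounded cC.
(* [hM] gives as bound any number above [M]; this one is also nonnegative. *)
exists (`|M| + 1); first by rewrite addr_ge0.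
set D := [set a | _].
have mD : measurable D by exact: measurable_cube.
have DC : ~` D `<=` [set a | ~ C (to_row a)].
  move=> a /= Da Ca; apply: Da => j.
  have M1 : M < `|M| + 1 by rewrite (le_lt_trans (ler_norm M))// ltrDl.
  have /= := hM _ M1 _ Ca; apply: le_trans.
  rewrite (_ : `|to_row a| = mx_norm (to_row a))// mx_normrE.
  by apply: le_trans (le_bigmax _ _ (ord0, j)); rewrite mxE.
have ADC : A (~` D) = 0%E.
  apply/eqP; rewrite eq_le measure_ge0 andbT -AC.
  by apply: le_measure; rewrite ?inE//; exact: measurableC.
by rewrite -[D]setCK probability_setC ?ADC ?sube0//; exact: measurableC.
Qed.

End compact_support.

(** * Comparison with the model *)

Section orthant_measures.
Context (R : realType) (n : nat) (A : probability (n.-tuple R) R).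

Lemma measurable_orthant : measurable (orthant R n).
Proof.
have -> : orthant R n =
    \bigcap_(j in [set: 'I_n]) ((fun a : n.-tuple R => tnth a j) @^-1` `[0, +oo[).
  apply/seteqP; split => a /= h j.
    by move=> _; rewrite /= in_itv/= andbT; exact: h.
  by have := h j I; rewrite /= in_itv/= andbT.
apply: fin_bigcap_measurable; first exact: finite_finset.
by move=> j _; rewrite -[X in measurable X]setTI; apply: measurable_tnth.
Qed.

(** Invariance under the transposition of [i] and [j] identifies the laws of the two coordinates. *)
Lemma symmetric_integral (f : R -> R) (i j : 'I_n) : permutation_symmetric A ->
  measurable_fun setT f -> (forall x, 0 <= f x) ->
  (\int[A]_a (f (tnth a i))%:E = \int[A]_a (f (tnth a j))%:E)%E.
Proof.
move=> symA mf f0.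
have mfE : measurable_fun setT (EFin \o f) by exact/measurable_EFinP.
rewrite -(integral_image_law A (measurable_tnth i) mfE)//.
rewrite -(integral_image_law A (measurable_tnth j) mfE)//.
apply: eq_measure_integral => B mB _.
rewrite /image_law /= /distribution /pushforward /=.
have := symA (tperm i j) [set a | B (tnth a j)].
rewrite (_ : [set a | _] = (fun a : n.-tuple R => tnth a i) @^-1` B); last first.
  by apply/seteqP; split => a /=; rewrite tnth_mktuple tpermR.
by apply; rewrite -[X in measurable X]setTI; apply: measurable_tnth.
Qed.

End orthant_measures.

Section link.
Context (R : realType) (N : nat) (alpha : nat -> R).
Variable A : forall n : nat, probability (n.-tuple R) R.
Hypothesis halpha_ge0 : forall n, (1 <= n <= N)%N -> 0 <= alpha n.
Hypothesis halpha_sum : \sum_(1 <= n < N.+1) alpha n = 1.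
Hypothesis hA_orthant : forall n, (1 <= n <= N)%N -> A n (orthant R n) = 1%E.
Hypothesis hA_sym : forall n, (1 <= n <= N)%N -> permutation_symmetric (A n).

(* [alpha] may be negative outside 1, ..., N. *)
Definition weight (i : nat) : R := `|alpha i.+1|.

Lemma weight_ge0 i : 0 <= weight i. Proof. exact: normr_ge0. Qed.

Lemma weightE (i : 'I_N) : weight i = alpha i.+1.
Proof. by rewrite /weight ger0_norm// halpha_ge0// ltn_ord. Qed.

Lemma weight_sum : \sum_(i < N) weight i = 1.
Proof.
rewrite -halpha_sum big_add1/= big_mkord; apply: eq_bigr => i _; exact: weightE.
Qed.

Local Notation step := (step weight_ge0 weight_sum A).
Local Notation lam := (lam N weight A).

Lemma measurable_head n : measurable_fun setT (fun a : n.+1.-tuple R => nth 0 a 0).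
Proof.
rewrite (_ : (fun a => _) = (fun a : n.+1.-tuple R => tnth a ord0)).
  exact: measurable_tnth.
by apply/funext => a; rewrite (tnth_nth 0).
Qed.

Lemma K_weight_ge0 i : 0 <= i.+1%:R * weight i.
Proof. by rewrite mulr_ge0// weight_ge0. Qed.

(** [K] is a bare set function; this version carries the measure structure that integration lemmas
    require. *)
Definition K_measure : {measure set R -> \bar R} :=
  msum (fun i => mscale (NngNum (K_weight_ge0 i))
    (image_law (A i.+1) (@measurable_head i))) N.

Lemma K_measureE : K N alpha A = K_measure.
Proof.
apply/funext => B; rewrite /K big_add1/= big_mkord /msum.
by apply: eq_bigr => i _; rewrite -weightE.
Qed.

(** By symmetry the factor [n] in [K] turns the moment of the first coordinate into the sum over all
    coordinates. *)
Lemma integral_K (p : R) : 0 < p ->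
  (\int[K N alpha A]_(a in `[0%R, +oo[) (a `^ p)%:E = lam p)%E.
Proof.
move=> p0; rewrite K_measureE.
have mp : measurable_fun setT (fun a : R => (a `^ p)%:E) by exact: measurable_powR_E.
have mpD : measurable_fun (`[0, +oo[%classic : set R) (fun a : R => (a `^ p)%:E).
  exact: measurable_funTS.
have p_ge0 (x : R) : (`[0, +oo[%classic : set R) x -> (0 <= (x `^ p)%:E)%E.
  by move=> _; rewrite lee_fin powR_ge0.
rewrite (ge0_integral_measure_sum _ (measurable_itv _) p_ge0 mpD).
apply: eq_bigr => i _.
rewrite (ge0_integral_mscale _ (measurable_itv _) _ mpD p_ge0).
have iN : (1 <= i.+1 <= N)%N by rewrite ltn_ord.
set P := image_law _ _.
have PD : P `[0, +oo[%classic = 1%E.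
  apply/eqP; rewrite eq_le probability_le1//= -(hA_orthant iN).
  apply: le_measure; rewrite ?inE.
  - exact: measurable_orthant.
  - by rewrite -[X in measurable X]setTI; apply: measurable_head.
  - by move=> a h; rewrite /= in_itv/= andbT; have := h ord0; rewrite (tnth_nth 0).
transitivity ((i.+1%:R * weight i)%:E * \int[A i.+1]_a (`|tnth a ord0| `^ p)%:E)%E.
  congr (_ * _)%E.
  transitivity (\int[P]_(x in `[0%R, +oo[) (`|x| `^ p)%:E)%E.
    apply: eq_integral => x; rewrite inE/= in_itv/= andbT => x0.
    by rewrite ger0_norm.
  have mn : measurable_fun setT (fun x : R => (`|x| `^ p)%:E).
    by apply/measurable_EFinP; exact: measurable_powRn.
  have n0 (x : R) : (0 <= (`|x| `^ p)%:E)%E by rewrite lee_fin powR_ge0.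
  rewrite (integral_full (measurable_itv _) PD mn n0).
  rewrite (integral_image_law (A i.+1) (@measurable_head i) mn n0).
  by apply: eq_integral => a _; rewrite (tnth_nth 0).
rewrite mulrC EFinM -muleA; congr (_ * _)%E.
rewrite /diag integral_sumE; first last.
- by move=> j a; exact: powR_ge0.
- by move=> j; exact: measurable_tnth_powR.
rewrite (eq_bigr (fun=> \int[A i.+1]_a (`|tnth a ord0| `^ p)%:E)%E); last first.
  move=> j _; apply: (symmetric_integral (f := fun t => `|t| `^ p)).
  - exact: hA_sym.
  - exact: measurable_powRn.
  - by move=> x; exact: powR_ge0.
by rewrite sumr_const card_ord mule_natl.
Qed.

Hypothesis hA_bounded : forall n, (1 <= n <= N)%N -> essentially_bounded (A n).

Lemma lam_lty p : 0 < p -> (lam p < +oo)%E.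
Proof.
move=> p0; apply: lte_sum_pinfty => i _; apply: lte_mul_pinfty => //.
- by rewrite lee_fin weight_ge0.
- by apply: diag_lty => //; apply: hA_bounded; exact: ltn_ord.
Qed.

Lemma off_lty s : 1 < s -> (off N weight A s < +oo)%E.
Proof.
move=> s1; apply: lte_sum_pinfty => i _; apply: lte_mul_pinfty => //.
  by rewrite lee_fin weight_ge0.
apply: lte_mul_pinfty => //.
- by rewrite lee_fin mulr_ge0 ?powR_ge0// ltW// (lt_trans _ s1).
- by apply: offdiag_lty => //; apply: hA_bounded; exact: ltn_ord.
Qed.

(** Finiteness ensures that [fine] in [lambda] does not return its default value 0. *)
Lemma lamE p : 0 < p -> lam p = (lambda N alpha A p)%:E.
Proof.
move=> p0; rewrite /lambda integral_K// fineK// ge0_fin_numE ?lam_lty//.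
by apply: lam_ge0; exact: weight_ge0.
Qed.

Lemma lambda_ge0 p : 0 < p -> 0 <= lambda N alpha A p.
Proof. by move=> p0; rewrite -lee_fin -lamE// lam_ge0//; exact: weight_ge0. Qed.

Lemma lambda_convex p1 p2 th : 0 < p1 -> 0 < p2 -> 0 < th -> th < 1 ->
  lambda N alpha A (th * p1 + (1 - th) * p2) <=
  th * lambda N alpha A p1 + (1 - th) * lambda N alpha A p2.
Proof.
move=> p10 p20 th0 th1; have th1' : 0 < 1 - th by rewrite subr_gt0.
rewrite -lee_fin EFinD !EFinM -!lamE ?addr_gt0 ?mulr_gt0//.
have wd p (i : 'I_N) : (0 <= (weight i)%:E * diag (A i.+1) p)%E.
  by rewrite mule_ge0 ?diag_ge0// lee_fin weight_ge0.
rewrite /lam !ge0_sume_distrr// -big_split/=; apply: lee_sum => i _.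
rewrite !(muleCA _ (weight i)%:E) -ge0_muleDr; first last.
- by rewrite mule_ge0 ?diag_ge0// lee_fin (ltW th1').
- by rewrite mule_ge0 ?diag_ge0// lee_fin (ltW th0).
apply: lee_wpmul2l; first by rewrite lee_fin weight_ge0.
exact: diag_convex.
Qed.

Lemma lambda_continuous p : 0 < p -> {for p, continuous (lambda N alpha A)}.
Proof.
move=> p0.
have e q : 0 < q -> lambda N alpha A q = \sum_(i < N) weight i * fine (diag (A i.+1) q).
  move=> q0; apply: EFin_inj; rewrite -lamE// -sumEFin; apply: eq_bigr => i _.
  rewrite EFinM fineK// ge0_fin_numE ?diag_ge0// diag_lty//.
  by apply: hA_bounded; exact: ltn_ord.
rewrite /prop_for /continuous_at e//.
have h : (fun q => \sum_(i < N) weight i * fine (diag (A i.+1) q)) @ p -->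
    \sum_(i < N) weight i * fine (diag (A i.+1) p).
  apply: cvg_big => //; first exact: add_continuous.
  move=> i _; apply: cvgMr; apply: continuous_diag => //.
  by apply: hA_bounded; exact: ltn_ord.
apply: cvg_trans h; apply: near_eq_cvg; near=> q; rewrite e//.
by near: q; exact: lt_nbhsr.
Unshelve. all: by end_near. Qed.

(** Agreement on nonnegative arguments suffices: [A n] is carried by the orthant and [y >= 0]. *)
Lemma Gamma_gain (u : R -> R) L y : (forall x, 0 <= x -> u x = lap L x) -> 0 <= y ->
  Gamma N alpha A u y = gain N weight A L y.
Proof.
move=> uL y0; rewrite /Gamma big_add1/= big_mkord; apply: eq_bigr => i _.
have iN : (1 <= i.+1 <= N)%N by rewrite ltn_ord.
rewrite weightE; congr (_ * _); rewrite /Rintegral; congr fine.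
rewrite -(integral_full (@measurable_orthant R i.+1) (hA_orthant iN)); first last.
- by move=> a; rewrite lee_fin lap_prod_ge0.
- by apply/measurable_EFinP; exact: measurable_lap_prod2.
apply: eq_integral => a; rewrite inE => a0; congr EFin; apply: eq_bigr => j _.
by rewrite uL ?mulr_ge0//= ger0_norm// mulrC.
Qed.

Lemma Gamma_step (m : R) (u : R -> R) L x : (forall x, 0 <= x -> u x = lap L x) ->
  0 <= x -> Gamma_ N alpha A m u x = lap (step m L) x.
Proof.
move=> uL x0; rewrite lap_step// /Gamma_ /Rintegral; congr fine.
rewrite integral_uniform; first last.
- by move=> tau; rewrite lee_fin gain_ge0//; exact: weight_ge0.
- by apply/measurable_EFinP; exact: measurable_gain_powR.
rewrite subr0 invr1 mul1e; apply: eq_integral => tau _.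
by rewrite (Gamma_gain uL)// mulr_ge0// powR_ge0.
Qed.

Lemma w_lap_iter k x : 0 <= x ->
  w_ N alpha A k x = lap (iter_step weight_ge0 weight_sum A (mu N alpha A 1) k) x.
Proof.
elim: k x => [|k IH] x x0; last by rewrite /w_ iterS; apply: Gamma_step.
apply: EFin_inj; rewrite lapE// integral_dirac//.
  by rewrite diracT mul1e normr1 mulr1.
by apply/measurable_EFinP; exact: measurable_lap_kernel2.
Qed.

End link.

Lemma mom_momentE (R : realType) (P : probability R R) (s : R) :
  P `[0%R, +oo[%classic = 1%E -> mom s P = moment P s.
Proof.
move=> P0.
have n0 (x : R) : (0 <= (`|x| `^ s)%:E)%E by rewrite lee_fin powR_ge0.
have mn : measurable_fun setT (fun x : R => (`|x| `^ s)%:E).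
  by apply/measurable_EFinP; exact: measurable_powRn.
rewrite /mom -(integral_full (measurable_itv _) P0 mn n0).
by apply: eq_integral => t; rewrite inE/= in_itv/= andbT => t0; rewrite ger0_norm.
Qed.

(** A convex function below a line at two points, strictly at one of them, is strictly below it in
    between. *)
Lemma convex_strict_between (R : realType) (l : R -> R) (m p1 p2 t : R) :
  (forall p1 p2 th, 0 < p1 -> 0 < p2 -> 0 < th -> th < 1 ->
    l (th * p1 + (1 - th) * p2) <= th * l p1 + (1 - th) * l p2) ->
  0 < p1 -> 0 < p2 -> l p1 <= 1 + m * p1 -> l p2 < 1 + m * p2 ->
  p1 < t < p2 \/ p2 < t < p1 -> l t < 1 + m * t.
Proof.
move=> lconv p10 p20 l1 l2 tp.
have [th [th0 th1 ->]] : exists th, [/\ 0 < th, th < 1 &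
    t = th * p1 + (1 - th) * p2].
  have d0 : p2 - p1 != 0.
    by rewrite subr_eq0; case: tp => /andP[a b]; rewrite ?(gt_eqF (lt_trans a b))//
      (lt_eqF (lt_trans a b)).
  (* The barycentric coordinate of [t]; numerator and denominator change sign together, so both
     orders are covered. *)
  exists ((p2 - t) / (p2 - p1)); split; last by field.
  - case: tp => /andP[a b]; first by rewrite divr_gt0// subr_gt0// (lt_trans a).
    rewrite -mulrNN -invrN !opprB divr_gt0// subr_gt0//.
    exact: lt_trans b.
  - case: tp => /andP[a b].
      by rewrite ltr_pdivrMr ?subr_gt0 ?(lt_trans a)// mul1r ltrD2l ltrN2.
    rewrite -mulrNN -invrN !opprB ltr_pdivrMr ?subr_gt0 ?(lt_trans a)//.
    by rewrite mul1r ltrD2r.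
apply: (le_lt_trans (lconv _ _ _ p10 p20 th0 th1)).
have th1' : 0 < 1 - th by rewrite subr_gt0.
have h1 := ler_wpM2l (ltW th0) l1.
have : (1 - th) * l p2 < (1 - th) * (1 + m * p2) by rewrite ltr_pM2l.
by lra.
Qed.

Lemma diag_eq0 (R : realType) n (A : probability (n.-tuple R) R) (s : R) :
  diag A s = 0%E -> diag A 1 = 0%E.
Proof.
move=> A0.
apply: (@integral_eq0_gap _ _ R A (fun a => \sum_(j < n) `|tnth a j| `^ s) (cst 0)).
- by apply: measurable_sum => j; exact: measurable_tnth_powR.
- by [].
- by apply: measurable_sum => j; exact: measurable_tnth_powR.
- by [].
- by move=> a; apply: sumr_ge0 => j _; exact: powR_ge0.
- by move=> a; apply: sumr_ge0 => j _; exact: powR_ge0.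
- move=> a h; rewrite lt_neqAle/=; apply/andP; split; last first.
    by apply: sumr_ge0 => j _; exact: powR_ge0.
  apply/eqP => /esym f0; move: h; rewrite big1 ?ltxx// => j _.
  have pos (i : 'I_n) : true -> 0 <= `|tnth a i| `^ s by rewrite powR_ge0.
  by have /powR_eq0_eq0 -> := psumr_eq0P pos f0 (i := j) isT; rewrite ?normr0 powR0.
- by move: A0; rewrite /diag => ->; rewrite prob_integral_cst.
- by rewrite prob_integral_cst ltry.
Qed.

(** Excludes [lambda(s) = 0] at a critical exponent: the coordinates of positive weight would vanish
    almost surely. *)
Lemma lam_eq0 (R : realType) N (c : nat -> R)
    (A : forall n : nat, probability (n.-tuple R) R) (s : R) :
  (forall i, 0 <= c i) -> lam N c A s = 0%E -> lam N c A 1 = 0%E.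
Proof.
move=> c0 l0.
have d0 (i : 'I_N) : (0 <= (c i)%:E * diag (A i.+1) s)%E.
  by rewrite mule_ge0 ?diag_ge0// lee_fin.
have h (i : 'I_N) : ((c i)%:E * diag (A i.+1) s = 0)%E.
  apply/eqP; rewrite eq_le d0 andbT -l0 /lam (bigD1 i)//= leeDl// sume_ge0//.
rewrite /lam big1// => i _; have /eqP := h i.
by rewrite mule_eq0 => /orP[/eqP ->|/eqP/diag_eq0 ->]; rewrite ?mul0e ?mule0.
Qed.

(** * Moments of the limit law *)

Section main.
Context (R : realType) (N : nat) (alpha : nat -> R).
Variable A : forall n : nat, probability (n.-tuple R) R.
Hypothesis halpha_ge0 : forall n, (1 <= n <= N)%N -> 0 <= alpha n.
Hypothesis halpha_sum : \sum_(1 <= n < N.+1) alpha n = 1.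
Hypothesis hA_orthant : forall n, (1 <= n <= N)%N -> A n (orthant R n) = 1%E.
Hypothesis hA_bounded : forall n, (1 <= n <= N)%N -> essentially_bounded (A n).
Hypothesis hA_sym : forall n, (1 <= n <= N)%N -> permutation_symmetric (A n).

Local Notation l := (lambda N alpha A).
Local Notation m := (mu N alpha A 1).
Local Notation step :=
  (step (@weight_ge0 R alpha) (weight_sum halpha_ge0 halpha_sum) A m).
Local Notation iter_step :=
  (iter_step (@weight_ge0 R alpha) (weight_sum halpha_ge0 halpha_sum) A m).

Lemma mu_lt p : 0 < p -> (mu N alpha A p < m) = (l p < 1 + m * p).
Proof. by move=> p0; rewrite [X in X < _]/mu ltr_pdivrMr// ltrBlDl. Qed.

Lemma mu_eq p : 0 < p -> (mu N alpha A p = m) <-> (l p = 1 + m * p).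
Proof.
move=> p0; rewrite [X in X = _]/mu; split=> [<-|->].
  by rewrite mulfVK ?gt_eqF// addrC subrK.
by rewrite addrC addrA addNr add0r mulfK ?gt_eqF.
Qed.

Lemma lambda1 : l 1 = 1 + m.
Proof. by rewrite /mu divr1 addrC subrK. Qed.

Variables (q : R).
Hypothesis q1 : 1 < q.
Hypothesis lq : l q < 1 + m * q.

Let lge0 := lambda_ge0 halpha_ge0 hA_orthant hA_sym hA_bounded.
Let lamE' := lamE halpha_ge0 hA_orthant hA_sym hA_bounded.
Let lconv := lambda_convex halpha_ge0 hA_orthant hA_sym hA_bounded.

(** If [m < 0] then [1 + m > 1 + m q > lambda(q) >= 0]. Such a [q] beyond 1 is what [p_0 > 1]
    supplies. *)
Lemma mass_gt0 : 0 < 1 + m.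
Proof.
have q0 : 0 < q by exact: lt_trans q1.
have := le_lt_trans (lge0 q0) lq.
have [m0 _|m0] := leP 0 m; first by rewrite ltr_pwDl.
by move/lt_trans; apply; rewrite ltrD2l gtr_nMr.
Qed.

Variables (w : R -> R) (P : probability R R).
Hypothesis hw : forall x : R, 0 <= x -> (fun n => w_ N alpha A n x) @ \oo --> w x.
Hypothesis hP_ge0 : P `[0%R, +oo[%classic = 1%E.
Hypothesis hP_laplace : forall x : R, 0 <= x ->
  w x = \int[P]_(tau in `[0, +oo[) expR (- (tau * x)).
Hypothesis hP_mean : (\int[P]_(tau in `[0%R, +oo[) tau%:E = 1)%E.

Lemma mom1P : mom 1 P = 1%E.
Proof.
rewrite mom_momentE// -hP_mean; apply: eq_integral => t.
by rewrite inE/= in_itv/= andbT => t0; rewrite powRr1.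
Qed.

Lemma w_lap x : 0 <= x -> w x = lap P x.
Proof.
move=> x0; rewrite hP_laplace// /lap /Rintegral; congr fine.
have n0 (t : R) : (0 <= (expR (- (x * `|t|)))%:E)%E by rewrite lee_fin expR_ge0.
have mn : measurable_fun setT (fun t : R => (expR (- (x * `|t|)))%:E).
  by apply/measurable_EFinP; exact: measurable_lap_kernel2.
rewrite -(integral_full (measurable_itv _) hP_ge0 mn n0).
apply: eq_integral => t; rewrite inE/= in_itv/= andbT => t0.
by rewrite ger0_norm// mulrC.
Qed.

Lemma lap_iter_step_cvg x : 0 <= x -> (fun k => lap (iter_step k) x) @ \oo --> lap P x.
Proof.
move=> x0; rewrite -w_lap//.
rewrite (_ : (fun k => _) = (fun k => w_ N alpha A k x)); first exact: hw.
by apply/funext => k; apply/esym/w_lap_iter.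
Qed.

(** The shifted iterates have two limits, one by continuity of [step] and one by hypothesis. *)
Lemma lap_stepP x : 0 <= x -> lap (step P) x = lap P x.
Proof.
move=> x0.
have h1 : (fun k => lap (iter_step k.+1) x) @ \oo --> lap (step P) x.
  exact: (@lap_step_cvg R N (weight alpha) (@weight_ge0 R alpha)
    (weight_sum halpha_ge0 halpha_sum) A m iter_step P x x0 lap_iter_step_cvg).
have h2 : (fun k => lap (iter_step k.+1) x) @ \oo --> lap P x.
  have := lap_iter_step_cvg x0.
  by rewrite -(@cvg_shiftS R^o (fun k => lap (iter_step k) x)).
exact: cvg_unique h1 h2.
Qed.

Lemma exists_order (s : R) : exists k : nat, s + 1 <= k%:R.
Proof. by exists (Num.truncn (s + 1)).+1; rewrite ltW// truncnS_gt. Qed.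

Lemma moment_lty s : 0 < s -> (forall t, 1 < t -> t <= s -> l t < 1 + m * t) ->
  (moment P s < +oo)%E.
Proof.
move=> s0 hs; rewrite -mom_momentE//.
have [k sk] := exists_order s.
(* The order [k] of the differences also serves as the depth of the induction on [s]. *)
have [] := @mom_iter_step_bounded R N (weight alpha) (@weight_ge0 R alpha)
  (weight_sum halpha_ge0 halpha_sum) A m _ mass_gt0 _ k s s0.
- by rewrite lamE'// lambda1.
- by move=> t t1; apply: off_lty.
- by rewrite (le_trans _ (le_trans sk _))// ?lerDl// ler_nat.
- by move=> t t1 ts; rewrite lamE' ?lte_fin ?hs// (lt_trans _ t1).
move=> B B0 hB; apply: (le_lt_trans _ (ltry B)).
exact: (mom_lsc s0 sk lap_iter_step_cvg hB).
Qed.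

Lemma moment_critical s : 1 < s -> l s = 1 + m * s -> moment P s = +oo%E.
Proof.
move=> s1 ls; apply/eqP; rewrite -leye_eq leNgt; apply/negP => Ps.
have s0 : 0 < s by exact: lt_trans s1.
have q0 : 0 < q by exact: lt_trans q1.
have [k sk] := exists_order s.
have Pfin : mom s P \is a fin_num.
  by rewrite ge0_fin_numE ?mom_ge0// mom_momentE.
have TP : (mom s (step P) <= mom s P)%E.
  rewrite -(fineK Pfin).
  (* Semicontinuity along the constant sequence [P], whose transform is that of [step P]. *)
  apply: (mom_lsc s0 sk (L_ := fun=> P)) => [y y0|_]; last by rewrite fineK.
  by rewrite lap_stepP//; exact: cvg_cst.
have D0 : 0 < 1 + m * s.
  rewrite lt_neqAle -ls lge0// andbT eq_sym; apply/eqP => l0.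
  have := @lam_eq0 R N (weight alpha) A s (@weight_ge0 R alpha).
  rewrite !lamE'// l0 => /(_ erefl) h; have m0 := EFin_inj h.
  by have := mass_gt0; rewrite -lambda1 m0 ltxx.
have lamD : lam N (weight alpha) A s = (1 + m * s)%:E by rewrite lamE'// ls.
have := no_critical_moment s1 D0 lamD _ _ TP q1.
rewrite mom1P mom_momentE// lte_fin ltr01 => /(_ isT Ps).
rewrite !lamE'// -EFinM -EFinD lee_fin lambda1 => h.
(* [h] reads [q (1 + m) <= lambda(q) + q - 1], against [lambda(q) < 1 + m q]. *)
by move: (le_lt_trans h (ltr_leD lq (lexx (q - 1)))); rewrite mulrDr mulr1; lra.
Qed.

Lemma moment_mono s t : 0 < s -> s <= t -> (moment P t < +oo)%E -> (moment P s < +oo)%E.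
Proof.
move=> s0 st; rewrite -!mom_momentE// => Pt.
apply: (le_lt_trans (mom_le_add1 P s0 st)).
by rewrite lte_add_pinfty// ltry.
Qed.

End main.

Theorem proposition10p1 (R : realType) (N : nat) (alpha : nat -> R)
    (A : forall n : nat, probability (n.-tuple R) R)
    (hN : (2 <= N)%N)
    (halpha_ge0 : forall n, (1 <= n <= N)%N -> 0 <= alpha n)
    (halpha_sum : \sum_(1 <= n < N.+1) alpha n = 1)
    (halphaN : 0 < alpha N)
    (hA_orthant : forall n, (1 <= n <= N)%N -> A n (orthant R n) = 1%E)
    (hA_compact : forall n, (1 <= n <= N)%N -> compactly_supported (A n))
    (hA_sym : forall n, (1 <= n <= N)%N -> permutation_symmetric (A n))
    (p0 : \bar R) (hp0 : is_p0 (mu N alpha A) p0) (hp0_gt1 : (1 < p0)%E)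
    (w : R -> R)
    (hw : forall x : R, 0 <= x -> (fun n => w_ N alpha A n x) @ \oo --> w x)
    (P : probability R R)
    (hP_ge0 : P `[0%R, +oo[%classic = 1%E)
    (hP_laplace : forall x : R, 0 <= x ->
      w x = \int[P]_(tau in `[0, +oo[) expR (- (tau * x)))
    (hP_mean : (\int[P]_(tau in `[0%R, +oo[) tau%:E = 1)%E) :
  [/\ ((forall s : R, 0 < s -> mu N alpha A s = mu N alpha A 1 -> s = 1) ->
        forall s : R, 0 < s -> (moment P s < +oo)%E),
      (forall sstar : R, 1 < sstar ->
        (forall s : R, 0 < s ->
          (mu N alpha A s = mu N alpha A 1 <-> s = 1 \/ s = sstar)) ->
        (forall s : R, 0 < s -> s < sstar -> (moment P s < +oo)%E) /\
        (forall s : R, sstar < s -> moment P s = +oo%E)) &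
      (forall sstar : R, 1 < sstar ->
        (forall s : R, 0 < s ->
          (mu N alpha A s = mu N alpha A 1 <-> s = 1 \/ s = sstar)) ->
        (moment P sstar < +oo)%E ->
        forall n, (2 <= n <= N)%N -> I_ P (A n) sstar = 0%E)].
Proof.
have hA_bounded n (hn : (1 <= n <= N)%N) := compactly_supported_bounded (hA_compact n hn).
have muE p (p0' : 0 < p) := mu_lt N alpha A p0'.
have lconv := lambda_convex halpha_ge0 hA_orthant hA_sym hA_bounded.
have l1 : lambda N alpha A 1 <= 1 + mu N alpha A 1 * 1.
  by rewrite mulr1 -lambda1.
(* Convexity: the line [1 + mu(1) t] is met at 1 and lies strictly above lambda at [p_0], hence also
   in between. *)
have below p : p0 = p%:E -> forall t, 1 < t -> t <= p ->
    lambda N alpha A t < 1 + mu N alpha A 1 * t.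
  move=> pE t t1 tp; move: hp0_gt1 hp0; rewrite pE lte_fin => p1 [ppos pmin].
  have lp : lambda N alpha A p < 1 + mu N alpha A 1 * p.
    by rewrite -muE// pmin// lt_eqF.
  move: tp; rewrite le_eqVlt => /orP[/eqP -> //|tp].
  by apply: (convex_strict_between lconv ltr01 ppos l1 lp); left; rewrite t1.
have decr : p0 = +oo%E -> forall t, 1 < t ->
    lambda N alpha A t < 1 + mu N alpha A 1 * t.
  move=> pE t t1; move: hp0; rewrite pE => /(_ _ _ ltr01 t1).
  by rewrite muE// (lt_trans _ t1).
have [q q1 lq] : exists2 q, 1 < q & lambda N alpha A q < 1 + mu N alpha A 1 * q.
  move: hp0_gt1; case E : p0 => [p| |//]; last first.
    by exists 2; rewrite ?ltr1n//; apply: decr; rewrite ?ltr1n.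
  by rewrite lte_fin => p1; exists p => //; exact: (below p).
have moment_lty := moment_lty halpha_ge0 halpha_sum hA_orthant hA_bounded hA_sym
  q1 lq hw hP_ge0 hP_laplace.
have critical sstar : 1 < sstar -> (forall s : R, 0 < s ->
      (mu N alpha A s = mu N alpha A 1 <-> s = 1 \/ s = sstar)) ->
    moment P sstar = +oo%E.
  move=> ss1 hs; have ss0 : 0 < sstar by exact: lt_trans ss1.
  apply: (moment_critical halpha_ge0 halpha_sum hA_orthant hA_bounded hA_sym
    q1 lq hw hP_ge0 hP_laplace hP_mean ss1).
  by apply/(mu_eq N alpha A ss0)/(hs _ ss0); right.
split=> [uniq s s0|sstar ss1 hs|sstar ss1 hs]; last first.
- by rewrite (critical _ ss1 hs) ltxx.
- have ss0 : 0 < sstar by exact: lt_trans ss1.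
  have ls : lambda N alpha A sstar <= 1 + mu N alpha A 1 * sstar.
    rewrite le_eqVlt; apply/orP; left; apply/eqP/(mu_eq N alpha A ss0).
    by apply/(hs _ ss0); right.
  split=> [s s0 sss|s sss].
    apply: moment_lty => // t t1 ts.
    move: hp0_gt1; case E : p0 => [p| |//]; last by move=> _; exact: decr.
    rewrite lte_fin => p1; have [tp|pt] := leP t p; first exact: (below p).
    (* Beyond [p_0] the exponent [t] lies between [p_0], where the inequality is strict, and
       [sstar], where it is an equality. *)
    apply: (convex_strict_between lconv ss0 _ ls (below p E p p1 (lexx p))).
      exact: lt_trans p1.
    by right; rewrite pt (le_lt_trans ts).
  apply/eqP; rewrite -leye_eq leNgt; apply/negP => /(moment_mono hP_ge0 ss0 (ltW sss)).
  by rewrite (critical _ ss1 hs) ltxx.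
- apply: moment_lty => // t t1 _.
  move: hp0_gt1; case E : p0 => [p| |//]; last by move=> _; exact: decr.
  rewrite lte_fin => p1; have [tp|pt] := leP t p; first exact: (below p).
  rewrite ltNge; apply/negP => lt_.
  have p_gt0 : 0 < p by exact: lt_trans p1.
  (* If the inequality failed at [t], then [h] would change sign on [[p, t]]; a zero there solves
     [mu(u) = mu(1)] with [u >= p > 1], against uniqueness. *)
  pose h u := lambda N alpha A u - (1 + mu N alpha A 1 * u).
  have ch : {within `[p, t], continuous h}.
    apply: continuous_in_subspaceT => u; rewrite inE/= in_itv/= => /andP[pu _].
    have u0 : 0 < u by exact: lt_le_trans pu.
    apply: cvgB.
      exact: (lambda_continuous halpha_ge0 hA_orthant hA_sym hA_bounded u0).
    by apply: cvgD; [exact: cvg_cst|exact: mulrl_continuous].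
  have hp : h p < 0 by rewrite subr_lt0; exact: (below p).
  have ht : 0 <= h t by rewrite subr_ge0.
  have [|u] := IVT (ltW pt) ch (v := 0).
    by rewrite ge_min (ltW hp) le_max ht orbT.
  rewrite in_itv/= => /andP[pu _] /eqP; rewrite subr_eq0 => /eqP lu.
  have u0 : 0 < u by exact: lt_le_trans pu.
  have u1 := uniq u u0 ((mu_eq N alpha A u0).2 lu).
  by move: (lt_le_trans p1 pu); rewrite u1 ltxx.
Qed.
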